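(* Let $\mathcal{P}$ be a set of $n\ge 5$ points in $\mathbb{R}^2$, no three collinear, whose convex hull is a triangle. Then \[ \hat{v}_0(\mathcal{P}) < \frac{11n}{112} < \frac{n}{10.18}. \]
   Context: A plane graph of a finite point set $\mathcal{P}\subset\mathbb{R}^2$ has vertex set $\mathcal{P}$ (with vertices at these fixed positions) and edge set a set of straight line segments between points of $\mathcal{P}$, no two of which cross (they may share endpoints). Plane graphs are distinguished by their edge sets, so the vertices are labeled. Let $\mathcal{G}(\mathcal{P})$ be the set of all plane graphs of $\mathcal{P}$. For $G\in\mathcal{G}(\mathcal{P})$, $v_i(G)$ is the number of vertices of degree $i$ in $G$. $\hat{v}_i(\mathcal{P})=\frac{1}{|\mathcal{G}(\mathcal{P})|}\sum_{G\in\mathcal{G}(\mathcal{P})} v_i(G)$ is the expected number of degree-$i$ vertices in a plane graph of $\mathcal{P}$ chosen uniformly at random. So $\hat{v}_0(\mathcal{P})$ is the expected number of isolated vertices. *)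

(* Defs.v *)
From HB Require Import structures.
From mathcomp Require Import all_boot all_order all_algebra.
From mathcomp Require Import finmap.
From mathcomp Require Import mathcomp_extra boolp classical_sets set_interval.
From mathcomp Require Import reals convex.
Set Implicit Arguments.
Unset Strict Implicit.
Unset Printing Implicit Defensive.
Import Order.TTheory GRing.Theory Num.Theory.
Local Open Scope ring_scope.

Definition segment (R : realType) (E : lmodType R) (p q : E) : set E :=
  [set (1 - t) *: p + t *: q | t in `[0, 1]%classic]%classic.

Definition convex_hull (R : realType) (E : lmodType R) (A : set E) : set E :=
  smallest (fun C : set E => convex_set C) A.

Definition collinear (R : realType) (E : lmodType R) (p q r : E) : Prop :=
  exists a d : E, forall z : E, z \in [:: p; q; r] ->
    exists t : R, z = a + t *: d.

Definition no_three_collinear (R : realType) (P : {fset 'rV[R]_2}) : Prop :=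
  forall p q r : 'rV[R]_2, p \in P -> q \in P -> r \in P ->
    p != q -> q != r -> p != r -> ~ collinear p q r.

Definition triangular_hull (R : realType) (P : {fset 'rV[R]_2}) : Prop :=
  exists a b c : 'rV[R]_2, ~ collinear a b c /\
    convex_hull [set` P]%classic = convex_hull [set a; b; c]%classic.

(* [fset_sub_type P], to which [P] coerces, is the finite type of the points of
   [P]; an edge is the set of its two endpoints, a graph is its set of edges. *)
Definition edge_segment (R : realType) (P : {fset 'rV[R]_2}) (e : {set P}) :
    set 'rV[R]_2 :=
  [set z | exists p q : P,
             e = [set p; q]%SET /\ segment (val p) (val q) z]%classic.

(* Two edges may meet only in a common endpoint. *)
Definition noncrossing (R : realType) (P : {fset 'rV[R]_2}) (e f : {set P}) :
    Prop :=
  forall z : 'rV[R]_2, edge_segment e z -> edge_segment f z ->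
    exists p : P, [/\ p \in e, p \in f & val p = z].

Definition plane_graph (R : realType) (P : {fset 'rV[R]_2})
    (G : {set {set P}}) : Prop :=
  (forall e : {set P}, e \in G -> #|e| = 2%N) /\
  (forall e f : {set P}, e \in G -> f \in G -> e != f -> noncrossing e f).

Definition plane_graphs (R : realType) (P : {fset 'rV[R]_2}) :
    {set {set {set P}}} :=
  [set G : {set {set P}} | `[< plane_graph G >]]%SET.

Definition degree (R : realType) (P : {fset 'rV[R]_2}) (G : {set {set P}})
    (p : P) : nat :=
  #|[set e in G | p \in e]%SET|.

Definition v_ (R : realType) (P : {fset 'rV[R]_2}) (i : nat)
    (G : {set {set P}}) : nat :=
  #|[set p : P | degree G p == i]%SET|.

Definition vhat (R : realType) (i : nat) (P : {fset 'rV[R]_2}) : R :=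
  (#|plane_graphs P|%:R)^-1 * \sum_(G in plane_graphs P) (v_ i G)%:R.

(* Main.v *)
(** Fix a plane graph [G] and a point [p], and remove the edges of [G] at [p].
    If [p] then sees exactly [k] points, the graphs that agree with [G] away
    from [p] are obtained by choosing any of the [k] edges at [p], since these
    never cross each other; so [p] is isolated with probability [2^-k].  If
    [T] is a maximal plane graph containing [G], then [k >= deg_T p].  Hence
    the expected number of isolated vertices is at most the largest weight
    [sum_p 2^-deg_T(p)] of a maximal plane graph [T].

    Let [N = n - 3] be the number of interior points and [A3], [A4] the numbers
    of interior points of degree 3 and 4 in [T].  The bounded faces of [T] are
    empty triangles.  Sorting the points by angle around a hull vertex, a face
    is determined by its middle vertex and the side on which it lies, so there
    are at most [2N + 1] faces.  Interior points of degree 3 are pairwise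
    nonadjacent, and an interior point of degree 4 has at most one interior
    neighbour of degree 3.  So each point counted by [A3] has three faces of
    its own, and each point counted by [A4] is on at least two faces that avoid
    the points counted by [A3], which gives [3 A3 + 2/3 A4 <= 2N + 1].  Together
    with [A3 + A4 <= N], and the fact that at most one hull vertex has degree 3,
    this bounds the weight of [T]. *)
Require Import Defs.
From HB Require Import structures.
From mathcomp Require Import all_boot all_order all_algebra.
From mathcomp Require Import finmap.
From mathcomp Require Import mathcomp_extra boolp classical_sets set_interval.
From mathcomp Require Import reals interval_inference convex.
From mathcomp Require Import ring lra zify.
Set Implicit Arguments.
Unset Strict Implicit.
Unset Printing Implicit Defensive.
Import Order.TTheory GRing.Theory Num.Theory.
Local Open Scope ring_scope.

(** Twice the signed area of the triangle [p q r], positive exactly when it runs counterclockwise;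
    as a function of any one argument it is affine. All geometric conditions below are signs of
    [det]. *)
HB.lock Definition det (R : realType) (p q r : 'rV[R]_2) : R :=
  (q 0 0 - p 0 0) * (r 0 1 - p 0 1) - (q 0 1 - p 0 1) * (r 0 0 - p 0 0).

HB.lock Definition lin (R : realType) (t : R) (p q : 'rV[R]_2) : 'rV[R]_2 :=
  (1 - t) *: p + t *: q.

(* Abstracting the atoms first spares [lra] comparing them up to conversion. *)
Ltac clear_nonarith :=
  repeat match goal with
  | H : @eq (matrix _ _ _) _ _ |- _ => clear H
  | H : is_true (~~ _) |- _ => clear H
  | H : forall _, _ |- _ => clear H
  | H : ?A |- _ => lazymatch A with _ /\ _ => clear H | and4 _ _ _ _ => clear H end
  end.
Ltac gendet :=
  clear_nonarith;
  repeat match goal with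
  | H : context [@det ?R ?a ?b ?c] |- _ =>
      let x := fresh "x" in set (x := @det R a b c) in *; clearbody x
  | |- context [@det ?R ?a ?b ?c] =>
      let x := fresh "x" in set (x := @det R a b c) in *; clearbody x
  end.
Ltac genfun f :=
  repeat match goal with
  | H : context [f ?a] |- _ => let x := fresh "x" in set (x := f a) in *; clearbody x
  | |- context [f ?a] => let x := fresh "x" in set (x := f a) in *; clearbody x
  end.
Ltac lra_over f g h k := clear_nonarith; genfun f; genfun g; genfun h; genfun k; lra.
Ltac dlra := gendet; lra.

Lemma finite_argmin (R : realType) (T : finType) (Q : T -> Prop) (k : T -> R) :
  (exists x, Q x) -> exists2 x, Q x & forall y, Q y -> k x <= k y.
Proof.
move=> [x0 /asboolP Q0].
case: (arg_minP k (P := fun x => `[< Q x >]) Q0) => x /asboolP Qx xmin.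
by exists x => // y /asboolP; apply: xmin.
Qed.

(** * Identities for the orientation determinant *)

Section Determinants.
Variable R : realType.
Implicit Types (p q r u v w a b c e : 'rV[R]_2) (s t : R).

Lemma lin0 p q : lin 0 p q = p.
Proof. by rewrite !lin.unlock subr0 scale1r scale0r addr0. Qed.

Lemma lin1 p q : lin 1 p q = q.
Proof. by rewrite !lin.unlock subrr scale1r scale0r add0r. Qed.

Lemma linC t p q : lin (1 - t) p q = lin t q p.
Proof. by rewrite !lin.unlock opprB addrC subrKC addrC. Qed.

Lemma lin_back t s p q : lin t (lin s p q) p = lin ((1 - t) * s) p q.
Proof. by rewrite !lin.unlock; apply/rowP => i; rewrite !mxE; ring. Qed.

Lemma detC p q r : det q r p = det p q r.
Proof. by rewrite !det.unlock; ring. Qed.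

Lemma detS p q r : det p r q = - det p q r.
Proof. by rewrite !det.unlock; ring. Qed.

Lemma det_swap p q r : det q p r = - det p q r.
Proof. by rewrite !det.unlock; ring. Qed.

Lemma det_xx p q : [/\ det p p q = 0, det p q p = 0 & det q p p = 0].
Proof. by split; rewrite !det.unlock; ring. Qed.

Lemma det_lin p q t u v : det p q (lin t u v) = (1 - t) * det p q u + t * det p q v.
Proof. by rewrite !det.unlock !lin.unlock !mxE; ring. Qed.

Lemma det_lin_ray p q z t : det p (lin t p z) q = t * det p z q.
Proof. by rewrite !det.unlock !lin.unlock !mxE; ring. Qed.

Lemma lin_ray k t p z : lin k p (lin t p z) = lin (k * t) p z.
Proof. by rewrite !lin.unlock; apply/rowP => i; rewrite !mxE; ring. Qed.

Lemma det_sum p q r w : det p q r = det w p q + det w q r + det w r p.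
Proof. by rewrite !det.unlock; ring. Qed.

(* Three-term Grassmann-Plucker relation. *)
Lemma det_GP p a b c d :
  det p a c * det p b d = det p a b * det p c d + det p a d * det p b c.
Proof. by rewrite !det.unlock; ring. Qed.

(** Up to the factor [det p q r], the coefficients on the right are the barycentric coordinates of
    [w] in the triangle [p q r], and the form [det a b] is affine. *)
Lemma det_bary p q r w a b :
  det p q r * det a b w =
  det w q r * det a b p + det p w r * det a b q + det p q w * det a b r.
Proof. by rewrite !det.unlock; ring. Qed.

(** If [p], [q], [r] are not collinear, the forms [det p q] and [det p r] are affine coordinates of
    the plane; the proof is Cramer's rule in each of the two coordinates. *)
Lemma point_eq p q r u v : det p q r != 0 ->
  det p q u = det p q v -> det p r u = det p r v -> u = v.
Proof.
move=> D0 e1 e2.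
have D (i : 'I_2) : det p q r * (u 0 i - v 0 i) =
    (r 0 i - p 0 i) * (det p q u - det p q v)
    - (q 0 i - p 0 i) * (det p r u - det p r v).
  case: (boolP (i == 0)) => [/eqP ->|i0]; first by rewrite !det.unlock; ring.
  have -> : i = 1 by apply/val_inj; case: i i0 => [[|[|]]].
  by rewrite !det.unlock; ring.
apply/rowP => i; apply/eqP; rewrite -subr_eq0.
move: (D i); rewrite e1 e2 !subrr !mulr0 subrr => /eqP.
by rewrite mulf_eq0 (negPf D0).
Qed.

Lemma on_ray p a b e : det p a b != 0 -> det p a e = 0 ->
  e = lin (det p e b / det p a b) p a.
Proof.
move=> D0 E0; apply: (point_eq D0).
  rewrite det_lin; by have [_ -> _] := det_xx p a; have [_ _ ->] := det_xx a p;
    rewrite E0 !mulr0 addr0.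
have [_ bb _] := det_xx p b; rewrite det_lin (_ : det p b p = 0);
  last by rewrite !det.unlock; ring.
by rewrite (detS p a b) (detS p e b); field.
Qed.

(* The first boundary point on the way out of a cone, in terms of the values
   of the two linear forms bounding the cone. *)
Lemma exit2 (a1 a2 b1 b2 : R) : 0 < a1 -> 0 < a2 -> ~ (0 < b1 /\ 0 < b2) ->
  exists t, [/\ 0 < t, t <= 1 &
    ((1 - t) * a1 + t * b1 = 0 /\ 0 <= (1 - t) * a2 + t * b2) \/
    (0 <= (1 - t) * a1 + t * b1 /\ (1 - t) * a2 + t * b2 = 0)].
Proof.
move=> a1p a2p nb.
have ratio (x y : R) : 0 < x -> y <= 0 -> [/\ 0 < x / (x - y), x / (x - y) <= 1 &
    forall x' y', (1 - x / (x - y)) * x' + x / (x - y) * y' =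
      (x * y' - x' * y) / (x - y)].
  move=> xp yn; have d : 0 < x - y by lra.
  split; first exact: divr_gt0.
    by rewrite ler_pdivrMr //; lra.
  by move=> x' y'; field; lra.
case: (lerP b1 0) => [h1|h1]; last first.
  have h2 : b2 <= 0 by case: (lerP b2 0) => // ?; case: nb.
  have [t0 t1 te] := ratio _ _ a2p h2.
  exists (a2 / (a2 - b2)); split=> //; right; rewrite !te; split.
    apply: divr_ge0; last lra.
    by have := mulr_gt0 a2p h1; have := mulr_ge0 (ltW a1p) (eqbRL (oppr_ge0 b2) h2); lra.
  by rewrite subrr mul0r.
have [t0 t1 te] := ratio _ _ a1p h1.
case: (lerP 0 (a1 * b2 - a2 * b1)) => [h|h].
  exists (a1 / (a1 - b1)); split=> //; left; rewrite !te; split.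
    by rewrite subrr mul0r.
  by apply: divr_ge0 => //; lra.
have h2 : b2 <= 0.
  case: (lerP b2 0) => // b2p.
  by have := mulr_gt0 a1p b2p; have := mulr_ge0 (ltW a2p) (eqbRL (oppr_ge0 b1) h1); lra.
have [s0 s1 se] := ratio _ _ a2p h2.
exists (a2 / (a2 - b2)); split=> //; right; rewrite !se; split.
  by apply: divr_ge0; lra.
by rewrite subrr mul0r.
Qed.

End Determinants.

(** * Crossings of edges in general position *)

Lemma collinear_det0 (R : realType) (p q r : 'rV[R]_2) :
  p != q -> det p q r = 0 -> collinear p q r.
Proof.
move=> pq D0; suff [t rE] : exists t, r = p + t *: (q - p).
  exists p, (q - p) => z; rewrite !inE => /or3P[] /eqP ->.
  - by exists 0; rewrite scale0r addr0.
  - by exists 1; rewrite scale1r addrC subrK.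
  - by exists t.
have I2 (i : 'I_2) : i = 0 \/ i = 1.
  case: (boolP (i == 0)) => [/eqP ->|i0]; first by left.
  by right; apply/val_inj; case: i i0 => [[|[|]]].
(* The parameter of [r] on the line is a quotient of coordinate differences, taken along an axis on
   which [p] and [q] differ. *)
case: (eqVneq (q 0 0) (p 0 0)) => e0; last first.
  have e0' : q 0 0 - p 0 0 != 0 by rewrite subr_eq0.
  exists ((r 0 0 - p 0 0) / (q 0 0 - p 0 0)); apply/rowP => i; rewrite !mxE.
  case: (I2 i) => ->; first by field.
  apply: (mulfI e0'); transitivity
    ((q 0 0 - p 0 0) * p 0 1 + (r 0 0 - p 0 0) * (q 0 1 - p 0 1)); last by field.
  by move: D0; rewrite !det.unlock; lra.
have e1 : q 0 1 - p 0 1 != 0.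
  apply: contra_neq pq => e1; apply/rowP => i; case: (I2 i) => -> //.
  by apply/esym/eqP; rewrite -subr_eq0 e1.
have r0 : r 0 0 = p 0 0.
  by apply: (mulfI e1); move: D0; rewrite !det.unlock e0; lra.
exists ((r 0 1 - p 0 1) / (q 0 1 - p 0 1)); apply/rowP => i; rewrite !mxE.
by case: (I2 i) => ->; [rewrite e0 r0; field | field].
Qed.

Section PlaneGraphs.
Variables (R : realType) (P : {fset 'rV[R]_2}).
Hypothesis genP : no_three_collinear P.
Implicit Types (p q r u v x y z a b c : P) (t s : R) (T G : {set {set P}}).
Local Notation dt p q r := (det (val p) (val q) (val r)).

Lemma val_neq p q : p != q -> val p != val q.
Proof. by apply: contra_neq => /val_inj. Qed.

Lemma det_neq0 p q r : p != q -> q != r -> p != r -> dt p q r != 0.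
Proof.
move=> pq qr pr; apply/eqP => /(collinear_det0 (val_neq pq)).
exact: genP (fsvalP p) (fsvalP q) (fsvalP r) (val_neq pq) (val_neq qr) (val_neq pr).
Qed.

Lemma det_eq0 p q r : p != q -> dt p q r = 0 -> r = p \/ r = q.
Proof.
move=> pq /eqP D0; case: (eqVneq r p) => [->|rp]; first by left.
case: (eqVneq r q) => [->|rq]; first by right.
by move: D0; rewrite (negPf (det_neq0 pq _ _)) // eq_sym.
Qed.

Lemma edge_segmentP p q (z : 'rV[R]_2) : edge_segment [set p; q]%SET z <->
  exists t, [/\ 0 <= t, t <= 1 & z = lin t (val p) (val q)].
Proof.
split=> [[p' [q' [e [t /= tI zE]]]]|[t [t0 t1 ->]]]; last first.
  by exists p, q; split=> //; rewrite lin.unlock; exists t => //=; rewrite in_itv /= t0.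
move: tI zE; rewrite in_itv /= => /andP[t0 t1] zE.
have {zE} -> : z = lin t (val p') (val q') by rewrite lin.unlock.
have pI : p \in [set p'; q']%SET by rewrite -e !inE eqxx.
have qI : q \in [set p'; q']%SET by rewrite -e !inE eqxx orbT.
have pI' : p' \in [set p; q]%SET by rewrite e !inE eqxx.
have qI' : q' \in [set p; q]%SET by rewrite e !inE eqxx orbT.
have [[-> ->]|[-> ->]] : (p = p' /\ q = q') \/ (p = q' /\ q = p').
- case/set2P: pI pI' qI' => pE; subst; case/set2P: qI => -> //; try by [left | right].
  + by rewrite !inE !orbb => _ /eqP ->; left.
  + by rewrite !inE !orbb => /eqP -> _; right.
- by exists t.
by exists (1 - t); split; [lra | lra | rewrite linC].
Qed.

Definition adj T p q := [set p; q]%SET \in T.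

Lemma adjC T p q : adj T p q = adj T q p.
Proof. by rewrite /adj finset.setUC. Qed.

Lemma adj_neq T p q : plane_graph T -> adj T p q -> p != q.
Proof. by case=> T2 _ /T2; rewrite cards2; case: eqP. Qed.

(** Applying the forms [det p q] and [det p v] to the common point leaves multiples of the nonzero
    [dt p q v], so two segments leaving [p] in different directions share only [p]. *)
Lemma lin_shared t s p q v : p != q -> q != v -> p != v ->
  lin t (val p) (val q) = lin s (val p) (val v) -> s = 0 /\ t = 0.
Proof.
move=> pq qv pv e; have D0 := det_neq0 pq qv pv.
have /eqP : s * dt p q v = 0.
  have : det (val p) (val q) (lin t (val p) (val q)) = 0 by rewrite det_lin
    !det.unlock; ring.
  by rewrite e det_lin => <-; rewrite !det.unlock; ring.
have /eqP : t * dt p q v = 0.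
  have : det (val p) (val v) (lin s (val p) (val v)) = 0 by rewrite det_lin
    !det.unlock; ring.
  by rewrite -e det_lin (detS (val p) (val q)) => e'; apply/eqP; rewrite -oppr_eq0 -e';
    apply/eqP; rewrite !det.unlock; ring.
by rewrite !mulf_eq0 (negPf D0) !orbF => /eqP -> /eqP ->.
Qed.

(** The parameters of the crossing point on both segments are kept explicit, since later arguments
    compare them along a ray. *)
Definition crossing t s p q u v :=
  [/\ 0 < t, t < 1, 0 < s, s < 1 & lin t (val p) (val q) = lin s (val u) (val v)] /\
  [/\ p != u, p != v, q != u & q != v].

Lemma crossing_eq0 t s p q u v : crossing t s p q u v ->
  (1 - s) * dt p q u + s * dt p q v = 0.
Proof. by case=> [[_ _ _ _ e] _]; rewrite -det_lin -e det_lin !det.unlock; ring. Qed.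

Lemma crossing_sym t s p q u v : crossing t s p q u v -> crossing s t u v p q.
Proof. by case=> [[? ? ? ? e]] [? ? ? ?]; do 2!split => //; rewrite eq_sym. Qed.

Lemma crossing_flip t s p q u v : crossing t s p q u v -> crossing t (1 - s) p q v u.
Proof.
by case=> [[? ? ? ? e]] [? ? ? ?]; do 2!split => //; rewrite ?linC ?e //; lra.
Qed.

(** Edges with a common endpoint meet only there, by [lin_shared]. If the four endpoints are
    distinct, a meeting point with parameter 0 or 1 would be a vertex on the other segment, hence
    three collinear points. *)
Lemma noncrossing_or_crossing p q u v : p != q -> u != v ->
  [set p; q]%SET != [set u; v]%SET ->
  noncrossing [set p; q]%SET [set u; v]%SET \/ exists t s, crossing t s p q u v.
Proof.
move=> pq uv ef.
case: (pselect (exists t s, crossing t s p q u v)) => [|nc]; first by right.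
left=> z /edge_segmentP[t [t0 t1 zE]] /edge_segmentP[s [s0 s1 zE']].
have e : lin t (val p) (val q) = lin s (val u) (val v) by rewrite -zE.
have qp : q != p by rewrite eq_sym.
have vq : p = u -> q != v by move=> pu; apply: contraNN ef => /eqP ->; rewrite pu.
have vp : q = u -> p != v.
  by move=> pu; apply: contraNN ef => /eqP ->; rewrite pu finset.setUC.
have uq : p = v -> q != u.
  by move=> pu; apply: contraNN ef => /eqP ->; rewrite pu finset.setUC.
have up : q = v -> p != u by move=> pu; apply: contraNN ef => /eqP ->; rewrite pu.
case: (eqVneq p u) => [pu|pu].
  have e' : lin t (val p) (val q) = lin s (val p) (val v) by rewrite e pu.
  have pv : p != v by rewrite pu.
  have [_ t00] := lin_shared pq (vq pu) pv e'.
  by exists p; split; [exact: finset.set21 | rewrite pu; exact: finset.set21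
    | rewrite zE t00 lin0].
case: (eqVneq p v) => [pv|pv].
  have e' : lin t (val p) (val q) = lin (1 - s) (val p) (val u) by rewrite e linC pv.
  have [_ t00] := lin_shared pq (uq pv) pu e'.
  by exists p; split; [exact: finset.set21 | rewrite pv; exact: finset.set22
    | rewrite zE t00 lin0].
case: (eqVneq q u) => [qu|qu].
  have e' : lin (1 - t) (val q) (val p) = lin s (val q) (val v) by rewrite linC e qu.
  have qv : q != v by rewrite qu.
  have [_ t00] := lin_shared qp pv qv e'.
  by exists q; split; [exact: finset.set22 | rewrite qu; exact: finset.set21
    | rewrite zE -linC t00 lin0].
case: (eqVneq q v) => [qv|qv].
  have e' : lin (1 - t) (val q) (val p) = lin (1 - s) (val q) (val u).
    by rewrite !linC e qv.
  have [_ t00] := lin_shared qp pu qu e'.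
  by exists q; split; [exact: finset.set22 | rewrite qv; exact: finset.set22
    | rewrite zE -linC t00 lin0].
have on_uv w : val w = lin s (val u) (val v) -> w = u \/ w = v.
  by move=> wE; apply: (det_eq0 uv); rewrite wE det_lin !det.unlock; ring.
have on_pq w : val w = lin t (val p) (val q) -> w = p \/ w = q.
  by move=> wE; apply: (det_eq0 pq); rewrite wE det_lin !det.unlock; ring.
case: nc; exists t, s; do 2!split=> //.
- rewrite lt_neqAle t0 andbT; apply/eqP => t00.
  by case: (on_uv p); [rewrite -e -t00 lin0 | move/eqP: pu | move/eqP: pv].
- rewrite lt_neqAle t1 andbT; apply/eqP => t00.
  by case: (on_uv q); [rewrite -e t00 lin1 | move/eqP: qu | move/eqP: qv].
- rewrite lt_neqAle s0 andbT; apply/eqP => t00.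
  by case: (on_pq u); [rewrite e -t00 lin0 | move=> up'; move: pu; rewrite up' eqxx
    | move=> uq'; move: qu; rewrite uq' eqxx].
- rewrite lt_neqAle s1 andbT; apply/eqP => t00.
  by case: (on_pq v); [rewrite e t00 lin1 | move=> vp'; move: pv; rewrite vp' eqxx
    | move=> vq'; move: qv; rewrite vq' eqxx].
Qed.

Lemma meet_edges T t s p q u v : plane_graph T -> adj T p q -> adj T u v ->
  0 <= t <= 1 -> 0 <= s <= 1 -> lin t (val p) (val q) = lin s (val u) (val v) ->
  [set p; q]%SET = [set u; v]%SET \/
  exists r, [/\ r \in [set p; q]%SET, r \in [set u; v]%SET & val r = lin t (val p) (val q)].
Proof.
move=> [_ Tnc] pq uv /andP[t0 t1] /andP[s0 s1] e.
case: (eqVneq [set p; q]%SET [set u; v]%SET) => ef; [by left | right].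
apply: (Tnc _ _ pq uv ef); apply/edge_segmentP; first by exists t.
by exists s.
Qed.

Lemma no_crossing T t s p q u v : plane_graph T -> adj T p q -> adj T u v ->
  ~ crossing t s p q u v.
Proof.
move=> pT pq uv [[t0 t1 s0 s1 e] [pu pv qu qv]].
have tI : 0 <= t <= 1 by lra.
have sI : 0 <= s <= 1 by lra.
case: (meet_edges pT pq uv tI sI e) => [/setP/(_ p)|[r [rp ru _]]].
  by rewrite !inE eqxx (negPf pu) (negPf pv).
move: rp ru; rewrite !inE => /orP[] /eqP ->.
  by rewrite (negPf pu) (negPf pv).
by rewrite (negPf qu) (negPf qv).
Qed.

Definition maximal_plane T :=
  plane_graph T /\ forall T', plane_graph T' -> T \subset T' -> T' = T.

Lemma maximal_plane_exists G : plane_graph G ->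
  exists2 T, maximal_plane T & G \subset T.
Proof.
move=> /asboolP pG.
have [T maxT GT] := maxset_exists (P := fun T => `[< plane_graph T >]) pG.
exists T => //; split; first by have := maxsetp maxT => /asboolP.
by move=> T' /asboolP pT' /(maxsetsup maxT pT').
Qed.

Lemma noncrossing_sym (e f : {set P}) : noncrossing e f -> noncrossing f e.
Proof. by move=> nc z fz ez; have [r [? ? ?]] := nc z ez fz; exists r. Qed.

Lemma plane_graph_edge T (e : {set P}) : plane_graph T -> e \in T ->
  exists p q, e = [set p; q]%SET.
Proof. by case=> T2 _ /T2 /eqP /cards2P[p [q [_ ->]]]; exists p, q. Qed.

(** If no edge crossed the segment [p q], adding it would give a larger plane graph. *)
Lemma nonadj_crossing T p q : maximal_plane T -> p != q -> ~~ adj T p q ->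
  exists t s u v, adj T u v /\ crossing t s p q u v.
Proof.
move=> [pT Tmax] pq npq; apply: contrapT => nc.
move: npq; rewrite /adj -(Tmax ([set p; q]%SET |: T)%SET) ?finset.subsetUr //.
  by rewrite !inE eqxx.
have nce f : f \in T -> [set p; q]%SET != f -> noncrossing [set p; q]%SET f.
  move=> fT; have [u [v fE]] := plane_graph_edge pT fT.
  rewrite fE => ef; rewrite fE in fT.
  case: (noncrossing_or_crossing pq (adj_neq pT fT) ef) => // [[t [s c]]].
  by case: nc; exists t, s, u, v.
split=> [e|e f]; rewrite !inE.
  by case/orP => [/eqP ->|/(proj1 pT) //]; rewrite cards2 pq.
case/orP => [/eqP ->|eT] /orP[/eqP ->|fT]; first by rewrite eqxx.
- exact: nce.
- by rewrite eq_sym => ?; apply/noncrossing_sym/nce.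
- exact: (proj2 pT).
Qed.

End PlaneGraphs.

(** * Visibility *)

Lemma prod_itv (R : realType) (k s : R) : 0 <= k <= 1 -> 0 <= s <= 1 ->
  0 <= (1 - k) * s <= 1.
Proof.
move=> /andP[k0 k1] /andP[s0 s1]; apply/andP; split.
  by apply: mulr_ge0; lra.
by apply: mulr_ile1; lra.
Qed.

Section Visibility.
Variables (R : realType) (P : {fset 'rV[R]_2}).
Hypothesis genP : no_three_collinear P.
Implicit Types (p q r u v x y z a b c : P) (t s : R) (T G : {set {set P}}).
Local Notation dt p q r := (det (val p) (val q) (val r)).

(** Follow the edge from [w], inside the corner at [p], towards [u]. If it left the cone, it would
    do so on the side of [a b] containing [p], hence on one of the edges [p a], [p b] at a point
    other than its far end. Edges of a plane graph can meet there only in [p], which is not an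
    endpoint of [u v]. *)
Lemma corner_exit T p a b u v s : plane_graph T ->
  adj T p a -> adj T p b -> adj T u v -> p != u -> p != v -> 0 <= s <= 1 ->
  let w := lin s (val u) (val v) in
  0 < dt p a b -> 0 < det (val p) (val a) w -> 0 < det (val b) (val p) w ->
  0 <= det (val a) (val b) w -> 0 < dt a b u ->
  0 < dt p a u /\ 0 < dt b p u.
Proof.
move=> pT pa pb uv pu pv /andP[s0 s1] w D0 wa wb wab uab; apply: contrapT => nu.
have [t [t0 t1]] := exit2 wa wb nu; rewrite -!det_lin.
set e := lin t w (val u) => eE.
have eE' : e = lin ((1 - t) * s) (val u) (val v).
  exact: lin_back.
have sI : 0 <= (1 - t) * s <= 1.
  by apply: prod_itv; rewrite ?s0 //; dlra.
have abe : 0 < det (val a) (val b) e.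
  have tu := mulr_gt0 t0 uab.
  have tw : 0 <= (1 - t) * det (val a) (val b) w by apply: mulr_ge0 => //; dlra.
  by rewrite /e det_lin; dlra.
have sumE := det_sum (val p) (val a) (val b) e.
have esE : det e (val a) (val b) = det (val a) (val b) e by rewrite -detC.
have epE : det e (val p) (val a) = det (val p) (val a) e by rewrite -detC.
have ebE : det e (val b) (val p) = det (val b) (val p) e by rewrite -detC.
(* The exit point [e] lies on the ray from [p] to [c]; its parameter is at most 1 because [e] has
   not passed the line [a b]. *)
have [c [c_ab pc [k [k0 k1 eL]]]] : exists c, [/\ c = a \/ c = b, adj T p c &
    exists k, [/\ 0 <= k, k <= 1 & lin k (val p) (val c) = e]].
  case: eE => -[e1 e2].
    exists a; split=> //; first by left.
    have D1 : dt p a b != 0 by rewrite gt_eqF.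
    exists (det (val p) e (val b) / dt p a b); split; last by rewrite -on_ray.
      by apply: divr_ge0; [rewrite (detC (val b)) | exact: ltW].
    by rewrite ler_pdivrMr // (detC (val b)); dlra.
  exists b; split=> //; first by right.
  have D1 : dt p b a != 0 by rewrite detS oppr_eq0 gt_eqF.
  have e1' : det (val p) (val b) e = 0 by rewrite det_swap e2 oppr0.
  exists (det (val p) e (val a) / dt p b a); split; last by rewrite -on_ray.
    by rewrite !(detS _ (val a)) invrN mulrNN; apply: divr_ge0 => //; rewrite ltW.
  by rewrite !(detS _ (val a)) invrN mulrNN ler_pdivrMr //; dlra.
have kI : 0 <= k <= 1 by rewrite k0.
case: (meet_edges pT pc uv kI sI (etrans eL eE')) => [/setP/(_ p)|[r [rpc ruv rE]]].
  by rewrite !inE eqxx (negPf pu) (negPf pv).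
case/set2P: rpc => rE'; first by move: ruv; rewrite rE' !inE (negPf pu) (negPf pv).
move: abe; rewrite -eL -rE rE'; case: c_ab => ->.
  by have [_ -> _] := det_xx (val a) (val b); rewrite ltxx.
by have [_ _ ->] := det_xx (val b) (val a); rewrite ltxx.
Qed.

(* Let the edge [u v] be the first one hit at [w] when going from [p] to [z].
   In the triangle [p w u], the point closest in angle to [w] is visible. *)
Lemma first_crossing_visible T p z u v t s : maximal_plane T -> p != z ->
  adj T u v -> crossing t s p z u v ->
  (forall u' v' t' s', adj T u' v' -> 0 < t' -> t' < 1 -> 0 <= s' <= 1 ->
     lin t' (val p) (val z) = lin s' (val u') (val v') -> t <= t') ->
  exists y al be, [/\ adj T p y, 0 <= al, 0 < be &
    forall q, det (val p) (val q) (val y) =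
      al * det (val p) (val q) (lin t (val p) (val z)) + be * dt p q u].
Proof.
move=> mT pz uv; have pT := proj1 mT => cr tmin.
have [[t0 t1 s0 s1 wE] [pu pv zu zv]] := cr.
set w := lin t (val p) (val z) in wE *.
have dpw (q : 'rV[R]_2) : det (val p) w q = t * det (val p) (val z) q.
  exact: det_lin_ray.
pose D := det (val p) w (val u).
have D0 : D != 0.
  by rewrite /D dpw; apply: mulf_neq0; [exact: lt0r_neq0 | exact: det_neq0].
(* [al] and [be] are the affine coordinates with origin [p] and unit points [w] and [u]. Dividing by
   the signed [D] treats both orientations of [p w u] at once. *)
pose al (q : 'rV[R]_2) := det (val u) (val p) q / D.
pose be (q : 'rV[R]_2) := det (val p) w q / D.
have al_lin k (q r : 'rV[R]_2) : al (lin k q r) = (1 - k) * al q + k * al r.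
  by rewrite /al det_lin; field.
have be_lin k (q r : 'rV[R]_2) : be (lin k q r) = (1 - k) * be q + k * be r.
  by rewrite /be det_lin; field.
have coord (q r : 'rV[R]_2) : det (val p) r q = al q * det (val p) r w + be q * det
  (val p) r (val u).
  have := det_GP (val p) r w q (val u).
  rewrite -/D /al /be => GP; apply: (mulIf D0).
  rewrite mulrDl mulrAC divfK // (mulrAC (det (val p) w q / D)) divfK //.
  by rewrite GP -(detC (val u)); lra.
have alp : al (val p) = 0 by rewrite /al !det.unlock; ring.
have bep : be (val p) = 0 by rewrite /be !det.unlock; ring.
have alu : al (val u) = 0 by rewrite /al !det.unlock; ring.
have beu : be (val u) = 1 by rewrite /be divff.
have alw : al w = 1 by rewrite /al -detC divff.
have bew : be w = 0 by rewrite /be; have [_ _ ->] := det_xx w (val p); rewrite mul0r.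
have pt_eq (q r : 'rV[R]_2) : al q = al r -> be q = be r -> q = r.
  move=> ea eb; apply: (@point_eq R (val p) w (val u)) => //.
    by apply: (mulIf (invr_neq0 D0)).
  by rewrite !(det_swap (val u)); congr (- _); apply: (mulIf (invr_neq0 D0)).
have wE0 : w = lin t (val p) (val z) by [].
have coord2 (q r : 'rV[R]_2) : det (val p) q r = D * (al q * be r - al r * be q).
  rewrite (coord r q) (detS _ w) (detC (val u)) -[det (val p) w q](divfK D0).
  by rewrite -[det (val u) _ q](divfK D0) -/(al q) -/(be q); ring.
clearbody al be w D; clear dpw D0.
have hv : al (val v) + be (val v) = 1.
  have := al_lin s (val u) (val v); have := be_lin s (val u) (val v).
  rewrite -wE alu beu alw bew => e1 e2.
  by apply: (mulfI (lt0r_neq0 s0)); lra_over al be al be.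
have bev : be (val v) < 0.
  have := be_lin s (val u) (val v); rewrite -wE beu bew => e1.
  by rewrite -(pmulr_rlt0 _ s0); lra_over al be al be.
(* [S] is the triangle [p w u] without its side on the line [p w], so [be] is positive on it. The
   minimum of [- (al / be)] selects a point [y] of [S] closest in angle to [w]. *)
pose S y := [/\ 0 <= al (val y), 0 < be (val y) & al (val y) + be (val y) <= 1].
have [y [y0 y1 y2] ymin] : exists2 y : P, S y & forall q : P, S q ->
    - (al (val y) / be (val y)) <= - (al (val q) / be (val q)).
  apply: (@finite_argmin R P S (fun y => - (al (val y) / be (val y)))).
  by exists u; rewrite /S alu beu add0r; split=> //; exact: ltr01.
have py : p != y by apply: contraTneq y1 => <-; rewrite bep ltxx.
exists y, (al (val y)), (be (val y)); split=> //.
apply: contraT => npy.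
have [t1' [s1' [u' [v' [uv' cr']]]]] := nonadj_crossing genP mT py npy.
(* The form [L] vanishes on the line [p y] and is positive on the side of [w]. An edge crossing
   [p y] has an endpoint with [L] positive, and [main] refutes this for either endpoint. *)
pose L (q : 'rV[R]_2) := al q * be (val y) - al (val y) * be q.
have LE (q : 'rV[R]_2) : L q = al q * be (val y) - al (val y) * be q by [].
have L_lin k (q r : 'rV[R]_2) : L (lin k q r) = (1 - k) * L q + k * L r.
  by rewrite /L al_lin be_lin; ring.
clearbody L.
suff main u1 v1 t2 s2 : adj T u1 v1 -> crossing t2 s2 p y u1 v1 -> ~ 0 < L (val u1).
  have [[a0 a1 b0 b1 e] _] := cr'.
  have nL1 := main _ _ _ _ uv' cr'.
  have nL2 : ~ 0 < L (val v').
    by apply: (main v' u' t1' (1 - s1')); [rewrite adjC | exact: crossing_flip].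
  have : L (lin s1' (val u') (val v')) = 0.
    by rewrite -e L_lin !LE alp bep; ring.
  rewrite L_lin => L0.
  have Lu0 : L (val u') = 0.
    have s1p : 0 < 1 - s1' by rewrite subr_gt0.
    have [n1 n2] : L (val u') <= 0 /\ L (val v') <= 0 by split; rewrite leNgt; apply/negP.
    apply: (mulfI (lt0r_neq0 s1p)); rewrite mulr0.
    have := mulr_ge0_le0 (ltW s1p) n1; have := mulr_ge0_le0 (ltW b0) n2.
    by clear -L0; genfun L; lra.
  have [[_ _ _ _ _] [pu' pv' yu' yv']] := cr'.
  have d0 : dt p u' y = 0 by rewrite coord2 -LE Lu0 mulr0.
  have uy' : u' != y by rewrite eq_sym.
  by have := det_neq0 genP pu' uy' py; rewrite d0 eqxx.
move=> uv1 [[a0 a1 b0 b1 e] [pu1 pv1 yu1 yv1]] Lu.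
set w' := lin t2 (val p) (val y) in e.
have alw' : al w' = t2 * al (val y) by rewrite al_lin alp; ring.
have bew' : be w' = t2 * be (val y) by rewrite be_lin bep; ring.
have Lw' : L w' = 0 by rewrite LE alw' bew'; ring.
have bw0 : 0 < be w' by rewrite bew' mulr_gt0.
have hw' : al w' + be w' < 1.
  rewrite alw' bew' -mulrDr; apply: le_lt_trans a1.
  by rewrite -[leRHS]mulr1 ler_pM2l.
pose h (q : 'rV[R]_2) := 1 - al q - be q.
have hE (q : 'rV[R]_2) : h q = 1 - al q - be q by [].
have h_lin k (q r : 'rV[R]_2) : h (lin k q r) = (1 - k) * h q + k * h r.
  by rewrite !hE al_lin be_lin; ring.
clearbody h w'.
have same : [set u; v]%SET = [set u1; v1]%SET -> False.
  move=> E; suff : h w' = 0 by rewrite hE; lra_over al be L h.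
  have hu0 r : r \in [set u; v]%SET -> h (val r) = 0.
    by case/set2P => ->; rewrite hE ?alu ?beu; lra_over al be L h.
  by rewrite e h_lin !hu0 ?E ?finset.set21 ?finset.set22 //; ring.
(* The edge [u1 v1] cannot meet [u v] between [w] and [u], with [u] excluded: the edges are distinct
   by [same], and a common endpoint would have [be] equal to [k], while [be] is 1 at [u] and
   negative at [v]. *)
have hit k : 0 <= k < 1 -> forall e', 0 <= e' <= 1 ->
    lin k w (val u) = lin e' (val u1) (val v1) -> False.
  move=> /andP[k0 k1] e' e'I eq.
  have sI : 0 <= (1 - k) * s <= 1.
    by apply: prod_itv; lra_over al be L h.
  move: eq; rewrite wE lin_back => eq.
  case: (meet_edges pT uv uv1 sI e'I eq) => // [[r [ruv _ rE]]].
  have : be (val r) = k by rewrite rE -lin_back -wE be_lin bew beu; ring.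
  by case/set2P: ruv => ->; lra_over al be L h.
(* On the way from [w'] to [u1], either [u1] is a point of [S] closer in angle to [w] than [y], or
   the edge leaves through the side [w u] or through the line [p w]. The first exit is excluded by
   [hit]; the second contradicts the choice of [w] as first hit, unless it happens at [w] itself,
   which is [hit] with [k = 0]. *)
have [||k [k0 k1]] := @exit2 R (be w') (h w') (be (val u1)) (h (val u1)) bw0.
- by rewrite hE; lra_over al be L h.
- move=> [bu hu].
  have alu1 : 0 < al (val u1).
    have : 0 < al (val u1) * be (val y).
      by have := mulr_ge0 y0 (ltW bu); move: Lu; rewrite LE; lra_over al be L h.
    by rewrite pmulr_lgt0.
  have : S u1 by split; [lra_over al be L h | done | move: hu; rewrite hE;
    lra_over al be L h].
  move/ymin; rewrite lerN2 ler_pdivrMr // mulrAC ler_pdivlMr //.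
  by move: Lu; rewrite LE; lra_over al be L h.
rewrite -be_lin -h_lin; set e1 := lin k w' (val u1) => eE.
have eE' : e1 = lin ((1 - k) * s2) (val u1) (val v1) by rewrite /e1 e lin_back.
have sI : 0 <= (1 - k) * s2 <= 1.
  by apply: prod_itv; lra_over al be L h.
have Le : 0 < L e1 by rewrite /e1 L_lin Lw' mulr0 add0r mulr_gt0.
clearbody e1.
have b1' : 0 <= be e1 by case: eE => -[] ? ?; lra_over al be L h.
have ale : 0 < al e1.
  have : 0 < al e1 * be (val y).
    by have := mulr_ge0 y0 b1'; move: Le; rewrite LE; lra_over al be L h.
  by rewrite pmulr_lgt0.
case: eE => -[e1b e1h]; last first.
  apply: (hit (be e1) _ _ sI); first by move: e1h; rewrite hE; lra_over al be L h.
  rewrite -eE'; apply: pt_eq; rewrite ?al_lin ?be_lin ?alw ?bew ?alu ?beu; last ring.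
  by move: e1h; rewrite hE; lra_over al be L h.
have e1E : e1 = lin (al e1 * t) (val p) (val z).
  have -> : lin (al e1 * t) (val p) (val z) = lin (al e1) (val p) w.
    by rewrite wE0 lin_ray.
  by apply: pt_eq; rewrite ?al_lin ?be_lin ?alp ?bep ?alw ?bew ?e1b; ring.
have ale1 : al e1 <= 1 by move: e1h; rewrite hE e1b; lra_over al be L h.
have tle : t <= al e1 * t.
  apply: (tmin u1 v1 _ ((1 - k) * s2)) => //; rewrite -?e1E //.
    exact: mulr_gt0.
  by apply: le_lt_trans t1; rewrite ger_pMl.
apply: (hit 0 _ _ sI); first by rewrite lexx ltr01.
rewrite -eE' lin0; apply: pt_eq; rewrite ?alw ?bew ?e1b //.
by apply/eqP; rewrite eq_le ale1 -(ler_pM2r t0) mul1r tle.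
Qed.
End Visibility.

Lemma lin_inj (R : realType) (t s : R) (p q : 'rV[R]_2) :
  p != q -> lin t p q = lin s p q -> t = s.
Proof.
move=> pq e; apply/eqP; rewrite -subr_eq0.
have : (t - s) *: (q - p) = 0.
  transitivity (lin t p q - lin s p q); last by rewrite e subrr.
  by rewrite !lin.unlock; apply/rowP => i; rewrite !mxE; ring.
move/eqP; rewrite scaler_eq0 => /orP[] //.
by move=> /eqP /subr0_eq qp; rewrite qp eqxx in pq.
Qed.

(** * Consecutive neighbours and the triangular faces at a corner *)

Section Corners.
Variables (R : realType) (P : {fset 'rV[R]_2}).
Hypothesis genP : no_three_collinear P.
Implicit Types (p q r u v x y z a b c : P) (t s : R) (T G : {set {set P}}).
Local Notation dt p q r := (det (val p) (val q) (val r)).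

(** The identity says that the vector from [p] to [y] is [al] times that to [w] plus [be] times that
    to [u]: some neighbour of [p] lies in the sector from [w] to [u], off the ray through [w]. *)
Definition visible_between T p (w : 'rV[R]_2) u :=
  exists y al be, [/\ adj T p y, 0 <= al, 0 < be &
    forall q, det (val p) (val q) (val y) =
      al * det (val p) (val q) w + be * dt p q u].

Lemma nonadj_visible T p z : maximal_plane T -> p != z -> ~~ adj T p z ->
  exists t s u v, [/\ adj T u v, crossing t s p z u v,
    visible_between T p (lin t (val p) (val z)) u &
    visible_between T p (lin t (val p) (val z)) v].
Proof.
move=> mT pz npz.
(* The parameter at which the line [u v] meets the line [p z]. It depends on the edge alone, so a
   first crossing exists as a minimum over finitely many pairs. *)
pose k (uv : P * P) := dt uv.1 uv.2 p / (dt uv.1 uv.2 p - dt uv.1 uv.2 z).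
have kE u v t : u != v -> p != u -> p != v ->
    (1 - t) * dt u v p + t * dt u v z = 0 -> t = k (u, v).
  move=> uv pu pv e.
  have [up vp] : u != p /\ v != p by rewrite !(eq_sym _ p).
  have A0 := det_neq0 genP uv vp up.
  have B0 : dt u v p - dt u v z != 0.
    by apply: contra_neq A0 => e'; clear -e e';
      move: (det _ _ _) (det _ _ _) e e' => *; nra.
  by apply: (mulIf B0);
    rewrite (_ : k _ = dt u v p / (dt u v p - dt u v z)) // divfK //; clear -e; dlra.
have [|[u v] [/= uv [t [s cr]]] kmin] := @finite_argmin R (P * P)%type
  (fun uv => adj T uv.1 uv.2 /\ exists t s, crossing t s p z uv.1 uv.2) k.
  by have [t [s [u [v [uv cr]]]]] := nonadj_crossing genP mT pz npz; exists (u, v);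
    split=> //; exists t, s.
have pT := proj1 mT.
have tk : t = k (u, v).
  have [_ [pu pv _ _]] := cr.
  by apply: kE => //; [exact: adj_neq uv | exact: (crossing_eq0 (crossing_sym cr))].
have tmin u' v' t' s' : adj T u' v' -> 0 < t' -> t' < 1 -> 0 <= s' <= 1 ->
    lin t' (val p) (val z) = lin s' (val u') (val v') -> t <= t'.
  move=> uv' t0 t1 /andP[s0 s1] e.
  have ne : [set p; z]%SET != [set u'; v']%SET.
    by apply: contraNneq npz => ne; rewrite /adj ne.
  case: (noncrossing_or_crossing genP pz (adj_neq pT uv') ne) => [nc|[t2 [s2 cr2]]].
    have [||r [rpz _]] := nc (lin t' (val p) (val z)).
    - by apply/edge_segmentP; exists t'; split=> //; exact: ltW.
    - by apply/edge_segmentP; exists s'.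
    case/set2P: rpz => -> e'.
      have := lin_inj (val_neq pz) (etrans (lin0 _ _) e').
      by move=> t00; rewrite -t00 ltxx in t0.
    have := lin_inj (val_neq pz) (etrans (lin1 _ _) e').
    by move=> t00; rewrite -t00 ltxx in t1.
  have [_ [pu pv _ _]] := cr2.
  rewrite (kE u' v' t') ?(adj_neq pT uv') //; last first.
    by rewrite -det_lin e det_lin !det.unlock; ring.
  by rewrite tk; apply: kmin; split=> //; exists t2, s2.
exists t, s, u, v; split=> //.
  exact: (first_crossing_visible genP mT pz uv cr tmin).
apply: (first_crossing_visible genP mT pz _ (crossing_flip cr)); first by rewrite adjC.
exact: tmin.
Qed.

(** If [p z] is not an edge, the first edge hit has an endpoint on the same side of [p x] as [z],
    and the neighbour found in the sector towards that endpoint is on that side too. *)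
Lemma neighbour_on_side T p x z : maximal_plane T -> 0 < dt p x z ->
  exists2 y, adj T p y & 0 < dt p x y.
Proof.
move=> mT xz; case: (boolP (adj T p z)) => [|npz]; first by exists z.
have pz : p != z.
  by apply: contraTneq xz => <-; have [_ -> _] := det_xx (val p) (val x); rewrite ltxx.
have [t [s [u [v [uv cr vu vv]]]]] := nonadj_visible mT pz npz.
have [[t0 t1 s0 s1 e] _] := cr.
have vis q : visible_between T p (lin t (val p) (val z)) q -> 0 < dt p x q ->
    exists2 y, adj T p y & 0 < dt p x y.
  move=> [y [al [be [py al0 be0 yE]]]] xq; exists y => //.
  rewrite yE det_lin; have [_ -> _] := det_xx (val p) (val x).
  rewrite mulr0 add0r; apply: ltr_wpDl; last exact: mulr_gt0.
  by apply: mulr_ge0 => //; apply: mulr_ge0; exact: ltW.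
case: (ltP 0 (dt p x u)) => xu; first exact: (vis u).
apply: (vis v) => //; rewrite ltNge; apply/negP => xv.
have : 0 < det (val p) (val x) (lin t (val p) (val z)).
  rewrite det_lin; have [_ -> _] := det_xx (val p) (val x).
  by rewrite mulr0 add0r mulr_gt0.
rewrite e det_lin ltNge => /negP; apply.
have s1' : 0 <= 1 - s by rewrite subr_ge0 ltW.
have := mulr_ge0_le0 (ltW s0) xv; have := mulr_ge0_le0 s1' xu.
by clear; dlra.
Qed.

Definition in_triangle a b c q :=
  [/\ 0 < dt a b q, 0 < dt b c q & 0 < dt c a q].

(** A point [q] inside the triangle is no neighbour of [p], so an edge hits [p q]. One of its
    endpoints is on the side of [a b] containing [p], hence in the cone by [corner_exit], and then
    [p] has a neighbour strictly between [a] and [b]. If [a b] were crossed, the crossing edge would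
    likewise end inside the empty triangle, or at [p], which again gives such a neighbour. *)
Lemma consecutive_face T p a b : maximal_plane T -> adj T p a -> adj T p b ->
  0 < dt p a b ->
  (forall y, adj T p y -> 0 < dt p a y -> 0 < dt b p y -> False) ->
  adj T a b /\ forall q, ~ in_triangle p a b q.
Proof.
move=> mT pa pb D0 none; have pT := proj1 mT.
have ab_nz : dt a b p = dt p a b by rewrite detC.
have bpa : dt b p a = dt p a b by rewrite -detC.
have paa : dt p a a = 0 by have [] := det_xx (val a) (val p).
have pap : dt p a p = 0 by have [] := det_xx (val p) (val a).
have bpp : dt b p p = 0 by have [] := det_xx (val p) (val b).
have bpb : dt b p b = 0 by have [] := det_xx (val b) (val p).
have aba : dt a b a = 0 by have [] := det_xx (val a) (val b).
have abb : dt a b b = 0 by have [] := det_xx (val b) (val a).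
have empty q : ~ in_triangle p a b q.
  move=> [q1 q2 q3].
  have pq : p != q by apply: contraTneq q1 => <-; rewrite pap ltxx.
  have npq : ~~ adj T p q by apply/negP => /none; apply.
  have [t [s [u [v [uv cr vu vv]]]]] := nonadj_visible mT pq npq.
  have main s' u' v' : adj T u' v' -> crossing t s' p q u' v' ->
      visible_between T p (lin t (val p) (val q)) u' -> ~ 0 < dt a b u'.
    move=> uv' [[t0 t1 s0 s1 e] [pu pv _ _]] [y [al [be [py al0 be0 yE]]]] abu.
    have w1 : 0 < det (val p) (val a) (lin s' (val u') (val v')).
      by rewrite -e det_lin pap mulr0 add0r mulr_gt0.
    have w2 : 0 < det (val b) (val p) (lin s' (val u') (val v')).
      by rewrite -e det_lin bpp mulr0 add0r mulr_gt0.
    have w3 : 0 <= det (val a) (val b) (lin s' (val u') (val v')).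
      by rewrite -e det_lin ab_nz addr_ge0 // mulr_ge0 // ?subr_ge0 ltW.
    have sI : 0 <= s' <= 1 by rewrite !ltW.
    have [u1 u2] := corner_exit pT pa pb uv' pu pv sI D0 w1 w2 w3 abu.
    apply: (none y py).
      by rewrite yE e; apply: ltr_wpDl; [apply: mulr_ge0 => //; exact: ltW
        | exact: mulr_gt0].
    have := mulr_ge0 al0 (ltW w2); have := mulr_gt0 be0 u2.
    by rewrite !(det_swap (val p) (val b)) yE e; clear; dlra.
  have nu := main s u v uv cr vu.
  have nv : ~ 0 < dt a b v.
    apply: (main (1 - s) v u); [by rewrite adjC | exact: crossing_flip | exact: vv].
  have [[t0 t1 s0 s1 e] _] := cr.
  have : 0 < det (val a) (val b) (lin t (val p) (val q)).
    by rewrite det_lin ab_nz addr_gt0 // mulr_gt0 // subr_gt0.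
  rewrite e det_lin ltNge => /negP; apply.
  have s1' : 0 <= 1 - s by rewrite subr_ge0 ltW.
  move/negP: nu; move/negP: nv; rewrite -!leNgt => nv nu.
  have := mulr_ge0_le0 (ltW s0) nv; have := mulr_ge0_le0 s1' nu.
  by clear; dlra.
split=> //; apply: contraT => nab.
have ab : a != b by apply: contraTneq D0 => <-; rewrite paa ltxx.
have [t [s [u [v [uv cr]]]]] := nonadj_crossing genP mT ab nab.
have main s' u' v' : adj T u' v' -> crossing t s' a b u' v' -> 0 < dt a b u' -> False.
  move=> uv' [[t0 t1 s0 s1 e] [au av bu bv]] abu.
  have w1 : 0 < det (val p) (val a) (lin s' (val u') (val v')).
    by rewrite -e det_lin paa mulr0 add0r mulr_gt0.
  have w2 : 0 < det (val b) (val p) (lin s' (val u') (val v')).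
    by rewrite -e det_lin bpb mulr0 addr0 bpa mulr_gt0 // subr_gt0.
  have w3 : det (val a) (val b) (lin s' (val u') (val v')) = 0.
    by rewrite -e det_lin aba abb !mulr0 addr0.
  have sI : 0 <= s' <= 1 by rewrite !ltW.
  case: (eqVneq p u') => [pu|pu].
    apply: (none v'); first by rewrite pu.
      by move: w1; rewrite det_lin -pu pap mulr0 add0r pmulr_rgt0.
    by move: w2; rewrite det_lin -pu bpp mulr0 add0r pmulr_rgt0.
  case: (eqVneq p v') => [pv|pv].
    move: w3; rewrite det_lin -pv ab_nz => /eqP; rewrite gt_eqF //.
    by rewrite addr_gt0 // mulr_gt0 // subr_gt0.
  have [] := corner_exit pT pa pb uv' pu pv sI D0 w1 w2 _ abu.
    by rewrite w3.
  by move=> u1 u2; apply: (empty u').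
have nu := main s u v uv cr.
have nv : ~ 0 < dt a b v.
  by apply: (main (1 - s) v u); [rewrite adjC | exact: crossing_flip].
have [[t0 t1 s0 s1 e] [au av bu bv]] := cr.
have c0 := crossing_eq0 cr.
have s1' : 0 < 1 - s by rewrite subr_gt0.
move/negP: nu; move/negP: nv; rewrite -!leNgt => nv nu.
have := mulr_ge0_le0 (ltW s0) nv; have := mulr_ge0_le0 (ltW s1') nu.
have u0 := det_neq0 genP ab bu au.
have u00 : dt a b u < 0 by rewrite lt_neqAle u0.
have : (1 - s) * dt a b u < 0 by rewrite pmulr_rlt0.
by clear -c0; dlra.
Qed.

(** The quotient of [dot] by the determinant is a positive multiple of the cotangent of the angle
    from [x] to [y], which decreases between 0 and pi; its maximum gives the smallest angle. *)
Lemma next_neighbour T p x z : maximal_plane T -> p != x -> 0 < dt p x z ->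
  exists2 y, adj T p y & 0 < dt p x y /\
    forall y', adj T p y' -> 0 < dt p x y' -> 0 < dt y p y' -> False.
Proof.
move=> mT px xz; have [y0 py0 xy0] := neighbour_on_side mT xz.
pose dot (y : 'rV[R]_2) := (val x 0 0 - val p 0 0) * (y 0 0 - val p 0 0)
  + (val x 0 1 - val p 0 1) * (y 0 1 - val p 0 1).
have [|y [py xy] ymin] := @finite_argmin R P (fun y => adj T p y /\ 0 < dt p x y)
  (fun y => - (dot (val y) / dt p x y)).
  by exists y0.
exists y => //; split=> // y' py' xy' yy'.
have := ymin y' (conj py' xy'); rewrite lerN2 ler_pdivrMr // mulrAC ler_pdivlMr //.
rewrite leNgt => /negP; apply; rewrite -subr_gt0.
have -> : dot (val y') * dt p x y - dot (val y) * dt p x y' = dot (val x) * dt y p y'.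
  by rewrite /dot !det.unlock; ring.
apply: mulr_gt0 => //.
rewrite /dot -!expr2 lt_neqAle eq_sym addr_ge0 ?sqr_ge0 // andbT.
rewrite paddr_eq0 ?sqr_ge0 // !sqrf_eq0 !subr_eq0.
apply: contra_neqN px => /andP[/eqP e0 /eqP e1]; apply/val_inj/rowP => i.
case: (boolP (i == 0)) => [/eqP -> //|i0].
by have -> : i = 1 by apply/val_inj; case: i i0 => [[|[|]]].
Qed.
End Corners.

(** * Neighbours in a maximal plane graph *)

Section Neighbours.
Variables (R : realType) (P : {fset 'rV[R]_2}).
Hypothesis genP : no_three_collinear P.
Implicit Types (p q r u v w x y z a b c : P) (t s : R) (T G : {set {set P}}).
Local Notation dt p q r := (det (val p) (val q) (val r)).

Definition nbrs T p : {set P} := [set y | adj T p y]%SET.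

Lemma in_nbrs T p y : (y \in nbrs T p) = adj T p y.
Proof. by rewrite inE. Qed.

Lemma det_pos_neq p q r : 0 < dt p q r -> [/\ p != q, q != r & p != r].
Proof.
move=> D; split; apply: contraTneq D => ->.
- by have [-> _ _] := det_xx (val q) (val r); rewrite ltxx.
- by have [_ _ ->] := det_xx (val r) (val p); rewrite ltxx.
- by have [_ -> _] := det_xx (val r) (val q); rewrite ltxx.
Qed.

Lemma det_pos_asym p q r : 0 < dt p q r -> 0 < dt p r q -> False.
Proof. by rewrite (detS (val p) (val q)) oppr_gt0 => h1 /(lt_trans h1); rewrite ltxx. Qed.

Lemma notin_set3 p a b c : p \notin [set a; b; c]%SET -> [/\ p != a, p != b & p != c].
Proof. by rewrite !inE !negb_or -andbA => /and3P[pa pb pc]; exact: And3 pa pb pc. Qed.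

Lemma cards3 x y z : x != y -> y != z -> x != z -> #|[set x; y; z]%SET| = 3%N.
Proof.
by move=> xy yz xz; rewrite -finset.setUA cardsU1 cards2 !inE negb_or xy xz yz.
Qed.

Lemma nbrs_eq3 T p x y z : x != y -> y != z -> x != z ->
  adj T p x -> adj T p y -> adj T p z -> #|nbrs T p| = 3%N ->
  nbrs T p = [set x; y; z]%SET.
Proof.
move=> xy yz xz px py pz p3; apply/esym/eqP.
rewrite eqEcard p3 (cards3 xy yz xz) leqnn andbT; apply/fintype.subsetP => v.
by rewrite !inE => /orP[/orP[]|] /eqP ->.
Qed.

Definition is_hull a b c := 0 < dt a b c /\
  forall q, [/\ 0 <= dt a b q, 0 <= dt b c q & 0 <= dt c a q].

Lemma is_hull_rot a b c : is_hull a b c -> is_hull b c a.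
Proof. by case=> D h; split; [rewrite detC | move=> q; case: (h q)]. Qed.

Lemma interior_pos a b c p : is_hull a b c -> p \notin [set a; b; c]%SET ->
  in_triangle a b c p.
Proof.
move=> [D h] /notin_set3[pa pb pc].
have [ab bc ac] := det_pos_neq D; have [h1 h2 h3] := h p.
have pos u v : u != v -> p != u -> p != v -> 0 <= dt u v p -> 0 < dt u v p.
  move=> uv pu pv d; rewrite lt_def d andbT.
  by apply: (det_neq0 genP uv); rewrite eq_sym; [exact: pv | exact: pu].
by split; [exact: pos | exact: pos | apply: pos; first by rewrite eq_sym].
Qed.

(** By [det_bary] at [p], a combination of [dt p x a], [dt p x b], [dt p x c] with positive weights
    is 0. If none were positive, all would vanish, and both [a] and [b] would lie on the line
    [p x]. *)
Lemma interior_side a b c p x : is_hull a b c -> p \notin [set a; b; c]%SET ->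
  p != x -> exists z, 0 < dt p x z.
Proof.
move=> H pI px; have [ia ib ic] := interior_pos H pI; have [D _] := H.
apply: contrapT => /forallNP none.
have nonpos z : dt p x z <= 0 by rewrite leNgt; apply/negP.
have B := det_bary (val a) (val b) (val c) (val p) (val p) (val x).
have [_ pxp _] := det_xx (val p) (val x); rewrite pxp mulr0 in B.
have pbc : dt p b c = dt b c p by rewrite -detC.
have apc : dt a p c = dt c a p by rewrite detC.
rewrite pbc apc in B.
have Ma := mulr_ge0_le0 (ltW ib) (nonpos a).
have Mb := mulr_ge0_le0 (ltW ic) (nonpos b).
have Mc := mulr_ge0_le0 (ltW ia) (nonpos c).
have za : dt p x a = 0 by apply: (mulfI (lt0r_neq0 ib)); rewrite mulr0;
  clear -B Ma Mb Mc; dlra.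
have zb : dt p x b = 0 by apply: (mulfI (lt0r_neq0 ic)); rewrite mulr0;
  clear -B Ma Mb Mc; dlra.
have [ab _ _] := det_pos_neq D.
move: pI; rewrite !inE.
case: (det_eq0 genP px za) => aE; first by rewrite aE eqxx.
case: (det_eq0 genP px zb) => bE; first by rewrite bE eqxx orbT.
by rewrite aE bE eqxx in ab.
Qed.

Section Interior.
Variables (T : {set {set P}}) (a b c : P).
Hypotheses (mT : maximal_plane T) (H : is_hull a b c).
Let pT := proj1 mT.

Definition interior p := p \notin [set a; b; c]%SET.

(** [y] is the first neighbour after [x] counterclockwise around [p], at an angle less than pi. *)
Definition next_nbr p x y := [/\ adj T p x, adj T p y, 0 < dt p x y &
  forall y', adj T p y' -> 0 < dt p x y' -> 0 < dt y p y' -> False].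

Definition is_face (f : {set P}) := exists x y z, [/\ f = [set x; y; z]%SET,
  [/\ adj T x y, adj T y z & adj T z x], 0 < dt x y z &
  forall q, ~ in_triangle x y z q].

Lemma next_exists p x : interior p -> adj T p x -> exists y, next_nbr p x y.
Proof.
move=> pI px; have pnx := adj_neq pT px.
have [z xz] := interior_side H pI pnx.
have [y py [xy none]] := next_neighbour genP mT pnx xz.
by exists y.
Qed.

(** Of two distinct candidates, one lies in the angle between the other and [y]. *)
Lemma next_inj p x x' y : next_nbr p x y -> next_nbr p x' y -> x = x'.
Proof.
move=> [px py xy none] [px' _ x'y none']; apply/eqP; apply: contraT => xx'.
have d0 := det_neq0 genP (adj_neq pT px) xx' (adj_neq pT px').
case: (ltgtP 0 (dt p x x')) => [xx|xx|xx]; last by rewrite -xx eqxx in d0.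
  by case: (none x' px' xx); rewrite -detC.
by case: (none' x px); [rewrite detS oppr_gt0 | rewrite -detC].
Qed.

Lemma next_neq p x y : next_nbr p x y -> x != y.
Proof. by case=> _ _ /det_pos_neq[]. Qed.

Lemma next_asym p x y : next_nbr p x y -> next_nbr p y x -> False.
Proof. by case=> _ _ h1 _ [_ _ h2 _]; exact: (det_pos_asym h1). Qed.

Lemma next_face p x y : next_nbr p x y -> is_face [set p; x; y]%SET /\ adj T x y.
Proof.
move=> [px py xy none]; have [axy empty] := consecutive_face genP mT px py xy none.
by split=> //; exists p, x, y; split=> //; split=> //; rewrite adjC.
Qed.

(** Start at any neighbour and take two successors. Each turn is less than pi, so the second
    successor is not the starting point. *)
Lemma interior_degree p : interior p -> (3 <= #|nbrs T p|)%N.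
Proof.
move=> pI; have [x px] : exists x, adj T p x.
  have [z0 pz0] : exists z0, p != z0.
    have [D _] := H; have [ab _ _] := det_pos_neq D.
    by have [pa _ _] := notin_set3 pI; exists a.
  have [z xz] := interior_side H pI pz0.
  by have [x px _] := neighbour_on_side genP mT xz; exists x.
have [y xy] := next_exists pI px; have [_ py _ _] := xy.
have [z yz] := next_exists pI py; have [_ pz _ _] := yz.
have xz : x != z by apply/eqP => e; move: yz; rewrite -e; exact: next_asym xy.
have <- : #|[set x; y; z]%SET| = 3%N.
  exact: cards3 (next_neq xy) (next_neq yz) xz.
by apply: subset_leq_card; apply/fintype.subsetP => w;
  rewrite !inE => /orP[/orP[]|] /eqP ->.
Qed.

Lemma interior_degree3 p x : interior p -> #|nbrs T p| = 3%N -> adj T p x ->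
  exists y z, [/\ nbrs T p = [set x; y;
    z]%SET, next_nbr p x y, next_nbr p y z & next_nbr p z x].
Proof.
move=> pI p3 px.
have [y xy] := next_exists pI px; have [_ py _ _] := xy.
have [z yz] := next_exists pI py; have [_ pz _ _] := yz.
have [w zw] := next_exists pI pz; have [_ pw _ _] := zw.
have xz : x != z by apply/eqP => e; move: yz; rewrite -e; exact: next_asym xy.
have E := nbrs_eq3 (next_neq xy) (next_neq yz) xz px py pz p3.
exists y, z; split=> //.
have : w \in nbrs T p by rewrite inE.
rewrite E !inE => /orP[/orP[]|] /eqP wE; rewrite wE in zw => //.
  by have := next_inj xy zw => e; rewrite e eqxx in xz.
by have := next_neq zw; rewrite eqxx.
Qed.

(** The faces at [p] make its other neighbours [y], [z] adjacent to [p'], so these are also the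
    other neighbours of [p']. Seen from [p], which lies inside it, the triangle [p' y z] is
    counterclockwise; the cyclic order around [p'] makes it clockwise. *)
Lemma interior_degree3_nonadj p p' : interior p -> interior p' ->
  #|nbrs T p| = 3%N -> #|nbrs T p'| = 3%N -> ~ adj T p p'.
Proof.
move=> pI pI' p3 p3' pp'; have p'p : adj T p' p by rewrite adjC.
have [y [z [E n1 n2 n3]]] := interior_degree3 pI p3 pp'.
have [y' [z' [E' m1 m2 m3]]] := interior_degree3 pI' p3' p'p.
have [_ ny] := next_face n1; have [_ nz] := next_face n3; rewrite adjC in nz.
have yin : y \in nbrs T p' by rewrite inE.
have zin : z \in nbrs T p' by rewrite inE.
have [_ py d1 _] := n1; have [_ pz d2 _] := n2; have [_ _ d3 _] := n3.
have [_ _ e1 _] := m1; have [_ _ e2 _] := m2; have [_ _ e3 _] := m3.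
have yp : y == p = false by rewrite eq_sym; exact: negbTE (adj_neq pT py).
have zp : z == p = false by rewrite eq_sym; exact: negbTE (adj_neq pT pz).
have yz := negPf (next_neq n2).
move: yin zin; rewrite E' !inE yp zp /= => /orP[/eqP yE|/eqP yE].
  by move: e1; rewrite -yE det_swap oppr_gt0 => /(lt_trans d1); rewrite ltxx.
case/orP => /eqP zE; last by rewrite yE zE eqxx in yz.
have := det_sum (val p') (val y) (val z) (val p).
move: e2; rewrite -yE -zE (detS _ (val y)) oppr_gt0 => e2 e4.
by have := lt_trans (addr_gt0 (addr_gt0 d1 d2) d3); rewrite -e4 => /(_ _ e2); rewrite ltxx.
Qed.

(** The neighbours of [x] other than [q] are neighbours [y], [z] of [q], with [q y z]
    counterclockwise and [z] following [x] around [q]. Were [x] and [x'] distinct, both would use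
    the remaining two neighbours of [q], with different successors, hence in opposite order, and the
    two orientations would conflict. *)
Lemma interior_degree4 q x x' : interior q -> interior x -> interior x' ->
  #|nbrs T q| = 4%N -> #|nbrs T x| = 3%N -> #|nbrs T x'| = 3%N ->
  adj T q x -> adj T q x' -> x = x'.
Proof.
move=> qI xI xI' q4 x3 x3' qx qx'; apply/eqP; apply: contraT => xx'.
have nxx' : ~ adj T x x' by exact: interior_degree3_nonadj.
have around u : interior u -> #|nbrs T u| = 3%N -> adj T q u ->
  exists y z, [/\ nbrs T u = [set q; y; z]%SET,
    [/\ adj T q y, adj T q z & y != z], 0 < dt q y z & next_nbr q u z].
  move=> uI u3 qu; have uq : adj T u q by rewrite adjC.
  have [y [z [E n1 n2 n3]]] := interior_degree3 uI u3 uq.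
  have [_ qy] := next_face n1; have [_ zq] := next_face n3.
  have [_ uy d1 _] := n1; have [_ uz d2 _] := n2; have [_ _ d3 _] := n3.
  exists y, z; split=> //; first by split; [exact: qy | rewrite adjC | exact: next_neq n2].
    by rewrite (det_sum _ _ _ (val u)) !addr_gt0.
  have [s qs] := next_exists qI qu; have [_ us] := next_face qs.
  have [_ qas ds _] := qs.
  have : s \in nbrs T u by rewrite inE.
  rewrite E !inE => /orP[/orP[]|] /eqP sE; last by rewrite -sE.
    by have := adj_neq pT qas; rewrite sE eqxx.
  by move: ds; rewrite sE det_swap oppr_gt0 => /(lt_trans d1); rewrite ltxx.
have [y [z [E [qy qz yz] d n]]] := around x xI x3 qx.
have [y' [z' [E' [qy' qz' yz'] d' n']]] := around x' xI' x3' qx'.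
have xy : adj T x y by rewrite -in_nbrs E !inE eqxx ?orbT.
have xz : adj T x z by rewrite -in_nbrs E !inE eqxx ?orbT.
have xy' : adj T x' y' by rewrite -in_nbrs E' !inE eqxx ?orbT.
have xz' : adj T x' z' by rewrite -in_nbrs E' !inE eqxx ?orbT.
have sub u v : adj T x u -> adj T x' v -> [/\ u != x, u != x', v != x & v != x'].
  move=> xu xv; split.
  - by rewrite eq_sym (adj_neq pT xu).
  - by apply/eqP => e; apply: nxx'; rewrite -e.
  - by apply/eqP => e; apply: nxx'; rewrite -e adjC.
  - by rewrite eq_sym (adj_neq pT xv).
have [n1 n2 n3 n4] := sub _ _ xy xy'; have [n5 n6 n7 n8] := sub _ _ xz xz'.
have Eq : nbrs T q = [set x; x'; y; z]%SET.
  apply/esym/eqP; rewrite eqEcard q4; apply/andP; split.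
    by apply/fintype.subsetP => v; rewrite !inE => /orP[/orP[/orP[]|]|] /eqP ->.
  by rewrite -!finset.setUA !cardsU1 cards1 !inE !negb_or xx' yz !(eq_sym x) !(eq_sym
    x') n1 n2 n5 n6.
have inq u : adj T q u -> u != x -> u != x' -> u = y \/ u = z.
  move=> qu ux ux'; have : u \in nbrs T q by rewrite inE.
  by rewrite Eq !inE (negPf ux) (negPf ux') /= => /orP[] /eqP ->; [left | right].
have zz' : z' != z.
  by apply/eqP => e; have := next_inj n; rewrite -e => /(_ _ n') xE; rewrite xE eqxx in xx'.
case: (inq z' qz' n7 n8) => [zE|zE]; last by rewrite zE eqxx in zz'.
case: (inq y' qy' n3 n4) => [yE|yE]; first by rewrite yE zE eqxx in yz'.
by move: d'; rewrite yE zE => /(det_pos_asym d).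
Qed.

End Interior.
End Neighbours.

(** * Degrees of the hull vertices *)

Section HullVertices.
Variables (R : realType) (P : {fset 'rV[R]_2}).
Hypothesis genP : no_three_collinear P.
Implicit Types (p q r u v w x y z a b c i l g h : P) (t s : R) (T G : {set {set P}}).
Local Notation dt p q r := (det (val p) (val q) (val r)).

(** All points other than [a] and [b] are strictly on one side of [a b], so no edge crosses it. *)
Lemma hull_adj T a b c : maximal_plane T -> is_hull a b c -> adj T a b.
Proof.
move=> mT [D h]; apply: contraT => nab.
have [ab _ _] := det_pos_neq D.
have [t [s [u [v [uv cr]]]]] := nonadj_crossing genP mT ab nab.
have c0 := crossing_eq0 cr; have [[t0 t1 s0 s1 _] [au av bu bv]] := cr.
have pos q : a != q -> b != q -> 0 < dt a b q.
  by move=> aq bq; have [d _ _] := h q; rewrite lt_def d andbT;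
    by have := det_neq0 genP ab bq aq.
have s1' : 0 < 1 - s by rewrite subr_gt0.
have := addr_gt0 (mulr_gt0 s1' (pos u au bu)) (mulr_gt0 s0 (pos v av bv)).
by rewrite c0 ltxx.
Qed.

Lemma det_xxx p q : [/\ dt p p q = 0, dt p q p = 0 & dt q p p = 0].
Proof. exact: det_xx. Qed.

(** If [b] and [c] were the only neighbours of [a], they would be consecutive and the whole hull
    triangle would be empty. *)
Lemma hull_degree T a b c i : maximal_plane T -> is_hull a b c -> interior a b c i ->
  (3 <= #|nbrs T a|)%N.
Proof.
move=> mT H iI; have [D _] := H.
have ab := hull_adj mT H.
have ac : adj T a c by rewrite adjC; apply: (hull_adj mT (is_hull_rot (is_hull_rot H))).
have [_ bc _] := det_pos_neq D.
have [y ay ybc] : exists2 y, adj T a y & y \notin [set b; c]%SET.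
  apply: contrapT => none; have onlybc y : adj T a y -> y = b \/ y = c.
    move=> ay; apply/set2P; apply: contraT => ybc; case: none; by exists y.
  have [|_ empty] := consecutive_face genP mT ab ac D.
    move=> y /onlybc[] ->.
      by have [_ _ ->] := det_xxx b a; rewrite ltxx.
    by have [_ -> _] := det_xxx c a; rewrite ltxx.
  exact: (empty i (interior_pos genP H iI)).
have [yb yc] : b != y /\ c != y by move: ybc;
  rewrite !inE negb_or !(eq_sym _ y) => /andP[h1 h2]; exact: conj h1 h2.
rewrite -(cards3 bc yc yb); apply: subset_leq_card; apply/fintype.subsetP => w.
by rewrite !inE => /orP[/orP[]|] /eqP ->.
Qed.

(** If both degrees were 3, the third neighbour [k] of [a] would also be the third neighbour of [b].
    The three triangles joining [k] to the hull sides would be empty, leaving no room for a second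
    interior point. *)
Lemma hull_degree3_unique T a b c i z : maximal_plane T -> is_hull a b c ->
  interior a b c i -> interior a b c z -> i != z ->
  #|nbrs T a| = 3%N -> #|nbrs T b| <> 3%N.
Proof.
move=> mT H i0I z0I iz0 a3 b3; have [D _] := H.
have ab := hull_adj mT H.
have bc := hull_adj mT (is_hull_rot H).
have ac : adj T a c by rewrite adjC; apply: (hull_adj mT (is_hull_rot (is_hull_rot H))).
have [nab nbc nac] := det_pos_neq D.
have [k ak kbc] : exists2 k, adj T a k & k \notin [set b; c]%SET.
  have : ~~ (nbrs T a \subset [set b; c]%SET).
    by apply/negP => /subset_leq_card; rewrite a3 cards2 nbc.
  by case/subsetPn => k; rewrite in_nbrs => ak kbc; exists k.
have [nbk nck] : b != k /\ c != k by move: kbc;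
  rewrite !inE negb_or !(eq_sym _ k) => /andP[h1 h2]; exact: conj h1 h2.
have nak := adj_neq (proj1 mT) ak.
have Na y : adj T a y -> [\/ y = b, y = c | y = k].
  rewrite -in_nbrs (nbrs_eq3 nbc nck nbk ab ac ak a3).
  by rewrite !inE => /orP[/orP[]|] /eqP ->; [constructor 1 | constructor 2 | constructor 3].
have kI : interior a b c k by rewrite /interior !inE !(eq_sym k) !negb_or nak nbk nck.
have [kab kbc' kca] := interior_pos genP H kI.
have aik : dt a k c = dt c a k by rewrite detC.
have [bk empty1] : adj T b k /\ forall q, ~ in_triangle a b k q.
  apply: consecutive_face => // y /Na[] -> d1 d2.
  - by move: d1; have [_ _ ->] := det_xxx b a; rewrite ltxx.
  - by move: d2; rewrite -detC det_swap oppr_gt0 => /(lt_trans kca); rewrite ltxx.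
  - by move: d2; have [_ -> _] := det_xxx k a; rewrite ltxx.
have [_ empty2] : adj T k c /\ forall q, ~ in_triangle a k c q.
  apply: consecutive_face => //; first by rewrite aik.
  move=> y /Na[] -> d1 d2.
  - exact: (det_pos_asym kab).
  - by move: d2; have [_ -> _] := det_xxx c a; rewrite ltxx.
  - by move: d1; have [_ _ ->] := det_xxx k a; rewrite ltxx.
have Nb y : adj T b y -> [\/ y = a, y = c | y = k].
  have ba : adj T b a by rewrite adjC.
  rewrite -in_nbrs (nbrs_eq3 nac nck nak ba bc bk b3).
  by rewrite !inE => /orP[/orP[]|] /eqP ->; [constructor 1 | constructor 2 | constructor 3].
have [_ empty3] : adj T c k /\ forall q, ~ in_triangle b c k q.
  apply: consecutive_face => // y /Nb[] -> d1 d2.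
  - by have kab' : 0 < dt k a b; [rewrite -detC | exact: det_pos_asym kab' d2].
  - by move: d1; have [_ _ ->] := det_xxx c b; rewrite ltxx.
  - by move: d2; have [_ -> _] := det_xxx k b; rewrite ltxx.
have [z' z'I kz] : exists2 z', interior a b c z' & k != z'.
  case: (eqVneq k z) => [kz|]; last by exists z.
  by exists i => //; rewrite kz eq_sym.
have [zab zbc zca] := interior_pos genP H z'I.
have [za zb zc] := notin_set3 z'I.
have nz u : k != u -> z' != u -> dt k u z' != 0.
  by move=> ku zu; apply: (det_neq0 genP ku) => //; rewrite eq_sym.
have [ka kb kc] := notin_set3 kI.
have A0 := nz a ka za; have B0 := nz b kb zb; have C0 := nz c kc zc.
(* Emptiness of the three triangles forces the determinants of [z'] against the lines from [k] to
   [a], [b], [c] to have one common sign, whereas their combination with positive weights is 0. *)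
have B := det_bary (val a) (val b) (val c) (val k) (val k) (val z').
have [_ kzk _] := det_xxx k z'; rewrite kzk mulr0 in B.
rewrite (_ : dt k b c = dt b c k) ?aik in B; last by rewrite -detC.
rewrite !(detS (val k) _ (val z')) in B.
have e1 : ~ (0 < dt k a z' /\ dt k b z' < 0).
  by move=> [h1 h2]; apply: (empty1 z'); split=> //; rewrite det_swap oppr_gt0.
have e2 : ~ (dt k a z' < 0 /\ 0 < dt k c z').
  by move=> [h1 h2]; apply: (empty2 z'); split=> //; rewrite det_swap oppr_gt0.
have e3 : ~ (0 < dt k b z' /\ dt k c z' < 0).
  by move=> [h1 h2]; apply: (empty3 z'); split=> //; rewrite det_swap oppr_gt0.
move: B A0 B0 C0 e1 e2 e3 kab kbc' kca; clear.
move: (dt k a z') (dt k b z') (dt k c z') (dt b c k) (dt c a k) (dt a b k).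
move=> A B C wa wb wc E A0 B0 C0 e1 e2 e3 kab kbc' kca.
case: (ltgtP A 0) A0 => // hA _; case: (ltgtP B 0) B0 => // hB _;
  case: (ltgtP C 0) C0 => // hC _; try by [case: e1 | case: e2 | case: e3].
- have := nmulr_rlt0 wa hA; have := nmulr_rlt0 wb hB; have := nmulr_rlt0 wc hC.
  by rewrite kab kbc' kca; have := nmulr_rgt0; lra.
- by have := mulr_gt0 kab hC; have := mulr_gt0 kbc' hA; have := mulr_gt0 kca hB; lra.
Qed.

(** The crossing point divides each segment in the ratio of the areas on its two sides. [A + B] and
    [C + D] both give twice the area of the quadrilateral with diagonals [p q] and [u v]. *)
Lemma crossing_of_signs p q u v : dt p q u < 0 -> 0 < dt p q v ->
  0 < dt u v p -> dt u v q < 0 -> exists t s, crossing t s p q u v.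
Proof.
move=> h1 h2 h3 h4.
have [pq qv pv] := det_pos_neq h2; have [uv vp up] := det_pos_neq h3.
have qu : q != u.
  by apply: contraTneq h1 => ->; have [_ _ ->] := det_xxx u p; rewrite ltxx.
set A := - dt p q u; set B := dt p q v; set C := dt u v p; set D := - dt u v q.
have AB : A + B = C + D by rewrite /A /B /C /D !det.unlock; ring.
have A0 : 0 < A by rewrite oppr_gt0.
have D0 : 0 < D by rewrite oppr_gt0.
have S0 : 0 < A + B by exact: addr_gt0.
exists (C / (A + B)), (A / (A + B)); split; last by rewrite (eq_sym p u).
have ratio k m : 0 < k -> 0 < m -> A + B = k + m -> 0 < k / (A + B) /\ k / (A + B) < 1.
  move=> k0 m0 e; rewrite divr_gt0 // ltr_pdivrMr // mul1r e; split=> //.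
  by rewrite ltrDl.
have [r1 r2] := ratio C D h3 D0 AB; have [r3 r4] := ratio A B A0 h2 erefl.
split=> //; apply: (@point_eq _ (val p) (val q) (val v)); first exact: lt0r_neq0.
- rewrite !det_lin; have [_ -> _] := det_xxx p q; have [_ _ ->] := det_xxx q p.
  rewrite -/B -[dt p q u]opprK -/A; field; exact: lt0r_neq0.
- rewrite !det_lin; have [_ -> _] := det_xxx p v; have [_ _ ->] := det_xxx v p.
  rewrite (detS (val p) (val q)) -/B (_ : dt p v u = - C);
    last by rewrite /C !det.unlock; ring.
  rewrite AB (_ : B = C + D - A); last by rewrite -AB; ring.
  by field; rewrite -AB; exact: lt0r_neq0.
Qed.
End HullVertices.

(** * Counting faces *)

Section RayParameters.
Variables (R : realType) (X Y t t' : R).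
Hypotheses (X0 : 0 < X) (tE : (1 - t) * Y + t * X = 0).

(** [Y] and [X] stand for [dt l r v] and [dt l r a], and [t] for the parameter, 0 at [v] and 1 at
    [a], where the line [l r] meets the line [v a]. *)
Lemma ray_param_pos : Y < 0 -> 0 < t.
Proof.
move=> Y0; rewrite ltNge; apply/negP => t0.
have t1 : 0 < 1 - t by lra.
have := mulr_ge0_le0 (ltW X0) t0.
have : (1 - t) * Y < 0 by rewrite pmulr_rlt0.
by move: tE; lra.
Qed.

Lemma ray_param_neg : 0 < Y -> t < 1 -> t < 0.
Proof.
move=> Y0 t1; rewrite ltNge; apply/negP => t0.
have t1' : 0 < 1 - t by lra.
by have := mulr_ge0 t0 (ltW X0); have := mulr_gt0 t1' Y0; move: tE; lra.
Qed.

Lemma ray_param_diff : (1 - t') * Y + t' * X = (t' - t) * (X - Y).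
Proof. by move: tE; lra. Qed.

Lemma ray_param_XY : t < 0 -> 0 < Y -> 0 < X - Y.
Proof.
move=> t0 Y0; have : t * (X - Y) < 0 by move: tE; lra.
by rewrite nmulr_rlt0.
Qed.

End RayParameters.

(** * Assigning faces injectively to slots *)

Section FaceSlots.
Variables (R : realType) (P : {fset 'rV[R]_2}).
Hypothesis genP : no_three_collinear P.
Implicit Types (p q r u v w x y z a b c i l g h : P) (t s : R) (G : {set {set P}}).
Local Notation dt p q r := (det (val p) (val q) (val r)).
Variables (T : {set {set P}}) (a b c : P).
Hypotheses (pT : plane_graph T) (H : is_hull a b c).

(** By [corner_exit] in both directions, an endpoint on the side of [g h] containing [p] would lie
    inside the empty triangle. As [w] itself is on that closed side, both endpoints are on the line
    [g h]. *)
Lemma edge_behind p g h u v s (w : 'rV[R]_2) : w = lin s (val u) (val v) -> adj T p g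
  -> adj T p h -> adj T u v ->
  p != u -> p != v -> 0 < s < 1 -> 0 < dt p g h ->
  (forall q, ~ in_triangle p g h q) ->
  0 < det (val p) (val g) w -> 0 < det (val h) (val p) w ->
  0 <= det (val g) (val h) w ->
  dt g h u = 0 /\ dt g h v = 0.
Proof.
move=> -> pg ph uv pu pv /andP[s0 s1] D0 empty w1 w2 w3.
have s1' : 0 < 1 - s by rewrite subr_gt0.
have nu : dt g h u <= 0.
  rewrite leNgt; apply/negP => ghu.
  have sI : 0 <= s <= 1 by rewrite !ltW.
  have [u1 u2] := corner_exit pT pg ph uv pu pv sI D0 w1 w2 w3 ghu.
  exact: (empty u).
have nv : dt g h v <= 0.
  rewrite leNgt; apply/negP => ghv.
  have sI : 0 <= 1 - s <= 1 by rewrite ltW //= lerBlDr lerDl ltW.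
  have vu : adj T v u by rewrite adjC.
  have := corner_exit pT pg ph vu pv pu sI D0; rewrite linC => /(_ w1 w2 w3 ghv)[u1 u2].
  exact: (empty v).
move: w3; rewrite det_lin => w3.
have m1 := mulr_ge0_le0 (ltW s1') nu; have m2 := mulr_ge0_le0 (ltW s0) nv.
split; [apply: (mulfI (lt0r_neq0 s1')) | apply: (mulfI (lt0r_neq0 s0))].
  by rewrite mulr0; clear -w3 m1 m2; dlra.
by rewrite mulr0; clear -w3 m1 m2; dlra.
Qed.

Lemma angle_b x y : 0 < dt a x y -> b != y.
Proof.
move=> axy; apply: contraTneq axy => <-; have [_ h] := H; have [d _ _] := h x.
by rewrite detS oppr_gt0 -leNgt.
Qed.

Lemma angle_c x y : 0 < dt a x y -> x != c.
Proof.
move=> axy; apply: contraTneq axy => ->; have [_ h] := H; have [_ _ d] := h y.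
by rewrite det_swap oppr_gt0 -leNgt.
Qed.

Lemma angle_pos q : a != q -> b != q -> 0 < dt a b q.
Proof.
move=> aq bq; have [D h] := H; have [d _ _] := h q.
have [ab _ _] := det_pos_neq D.
by have := det_neq0 genP ab bq aq; rewrite lt_def d andbT.
Qed.

(** All points are on one side of [a b], so the Grassmann-Plucker relation with [b] as reference has
    coefficients of known sign. *)
Lemma angle_trans x y z : 0 < dt a x y -> 0 < dt a y z -> 0 < dt a x z.
Proof.
move=> xy yz; have [ax _ ay] := det_pos_neq xy; have [_ _ az] := det_pos_neq yz.
have by_ := angle_pos ay (angle_b xy); have bz := angle_pos az (angle_b yz).
have [_ h] := H; have [bx _ _] := h x.
rewrite -(pmulr_rgt0 _ by_) det_GP.
apply: ltr_wpDl; last exact: mulr_gt0.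
by apply: mulr_ge0 => //; exact: ltW.
Qed.

(* The points other than [a] are ordered by angle around [a].  A face without
   vertex [a] is sent to its middle vertex [v] and the side of [v] on which it
   lies.  A face with vertices [a], [x], [v] is sent to the slot [(v, true)] on
   the side of [a], which is free since the edge [a v] blocks it. *)
Definition side_face (f : {set P}) v (bt : bool) := exists l r,
  [/\ f = [set l; v; r]%SET, [/\ adj T l v, adj T v r & adj T l r],
     0 < dt a l v /\ 0 < dt a v r, bt = (0 < dt l v r) &
     forall q, ~ in_triangle l v r q /\ ~ in_triangle v l r q].

Definition apex_face (f : {set P}) v := exists x,
  [/\ f = [set a; x; v]%SET, [/\ adj T a x, adj T x v & adj T a v],
     0 < dt a x v & forall q, ~ in_triangle a x v q].

Definition has_slot (f : {set P}) (s : P * bool) :=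
  side_face f s.1 s.2 \/ (s.2 /\ apex_face f s.1).

(** As [v] is between [l] and [r] in angle, the segment [l r] meets the ray from [a] through [v];
    [s] is a ratio of areas. [t < 1] holds because the meeting point, like [v], is strictly on the
    inner side of [a b]. *)
Lemma ray_hit l v r : 0 < dt a l v -> 0 < dt a v r ->
  exists s t, [/\ 0 < s < 1, lin s (val l) (val r) = lin t (val v) (val a), t < 1,
    (1 - t) * dt l r v + t * dt l r a = 0 & 0 < dt l r a].
Proof.
move=> lv vr; have lr := angle_trans lv vr.
have lra0 : 0 < dt l r a by rewrite detC.
have S0 := addr_gt0 lv vr.
pose s := dt a l v / (dt a l v + dt a v r).
have sI : 0 < s < 1 by rewrite /s divr_gt0 //= ltr_pdivrMr // mul1r ltrDl.
have [s0 s1] := andP sI.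
pose w := lin s (val l) (val r).
have w0 : det (val v) (val a) w = 0.
  rewrite det_lin (_ : dt v a l = dt a l v); last by rewrite -detC.
  rewrite (_ : dt v a r = - dt a v r); last by rewrite det_swap.
  by rewrite /s; field; exact: lt0r_neq0.
have D1 : dt v a r != 0 by rewrite det_swap oppr_eq0; exact: lt0r_neq0.
pose t := det (val v) w (val r) / dt v a r.
have wE : w = lin t (val v) (val a) by exact: on_ray.
exists s, t; split=> //; last first.
  by rewrite -det_lin -wE /w det_lin; have [_ -> _] := det_xxx l r;
    have [_ _ ->] := det_xxx r l; rewrite !mulr0 addr0.
have [al _ av] := det_pos_neq lv; have [_ _ ar] := det_pos_neq vr.
have bv := angle_pos av (angle_b lv); have br := angle_pos ar (angle_b vr).
have [_ h] := H; have [bl _ _] := h l.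
have : 0 < det (val a) (val b) w.
  rewrite /w det_lin; apply: ltr_wpDl; last exact: mulr_gt0.
  by apply: mulr_ge0 => //; rewrite subr_ge0 ltW.
rewrite wE det_lin; have [_ -> _] := det_xxx a b.
by rewrite mulr0 addr0 pmulr_lgt0 // subr_gt0.
Qed.

Lemma det_ne l v r : 0 < dt a l v -> 0 < dt a v r -> dt l v r != 0.
Proof.
move=> lv vr; have [_ nlv _] := det_pos_neq lv; have [_ nvr _] := det_pos_neq vr.
by have [_ nlr _] := det_pos_neq (angle_trans lv vr); exact: det_neq0.
Qed.

(** The last hypothesis says that [l' r'] meets the line [v a] no farther from [v] than [l r] does.
    Then the edge [l' r'] passes through the face [l v r] or along its side [l r], and [edge_behind]
    puts it on the line [l r]. *)
Lemma side_face_le v l r l' r' s t s' t' (bt : bool) :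
  [/\ adj T l v, adj T v r & adj T l r] -> 0 < dt a l v -> 0 < dt a v r ->
  bt = (0 < dt l v r) ->
  (forall q, ~ in_triangle l v r q /\ ~ in_triangle v l r q) ->
  [/\ adj T l' v, adj T v r' & adj T l' r'] -> 0 < dt a l' v -> 0 < dt a v r' ->
  bt = (0 < dt l' v r') ->
  [/\ 0 < s < 1, lin s (val l) (val r) = lin t (val v) (val a), t < 1,
    (1 - t) * dt l r v + t * dt l r a = 0 & 0 < dt l r a] ->
  [/\ 0 < s' < 1, lin s' (val l') (val r') = lin t' (val v) (val a), t' < 1,
    (1 - t') * dt l' r' v + t' * dt l' r' a = 0 & 0 < dt l' r' a] ->
  (if bt then t' <= t else t <= t') -> l = l' /\ r = r'.
Proof.
move=> [lv vr lr] alv avr btE empty [lv' vr' lr'] alv' avr' btE'.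
move=> [sI wE t1 tE X0] [sI' wE' t1' tE' X0'] tt.
have nlr : l != r by exact: adj_neq lr.
have nvl' : v != l' by rewrite eq_sym; exact: adj_neq lv'.
have nvr' : v != r' by exact: adj_neq vr'.
suff [d1 d2] : dt l r l' = 0 /\ dt l r r' = 0.
  have [l'E r'E] := (det_eq0 genP nlr d1, det_eq0 genP nlr d2).
  have l'l : l' = l.
    case: l'E => // l'r; move: alv'; rewrite l'r detS oppr_gt0 => h.
    by have := lt_trans avr h; rewrite ltxx.
  split=> //; case: r'E => // r'l; move: avr'; rewrite r'l detS oppr_gt0 => h.
  by have := lt_trans alv h; rewrite ltxx.
have Y0 := det_ne alv avr; have Y0' := det_ne alv' avr'.
have YE : dt l v r = - dt l r v by rewrite detS.
have YE' : dt l' v r' = - dt l' r' v by rewrite detS.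
have vlv : dt v l v = 0 by have [_ ->] := det_xxx v l.
have vrv : dt v r v = 0 by have [_ ->] := det_xxx v r.
have lvv : dt l v v = 0 by have [_ _ ->] := det_xxx v l.
have rvv : dt r v v = 0 by have [_ _ ->] := det_xxx v r.
have vra : dt v r a = dt a v r by rewrite detC.
have lva : dt l v a = dt a l v by rewrite detC.
have vl : adj T v l by rewrite adjC.
(* For [true] the face lies between [v] and [a]: parameters are positive and the corner at [v] turns
   from [r] to [l]. For [false] it lies beyond [v], with both reversed. *)
case: bt btE btE' tt => [/esym btE /esym btE'|/esym/negbT btE /esym/negbT btE'] tt.
  have D0 : 0 < dt v r l by rewrite (detC (val l)).
  have Yn' : dt l' r' v < 0 by rewrite -oppr_gt0 -YE'.
  have Yn : dt l r v < 0 by rewrite -oppr_gt0 -YE.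
  have tp := ray_param_pos X0' tE' Yn'.
  have empty' q : ~ in_triangle v r l q.
    by move=> [q1 q2 q3]; have [nq _] := empty q; apply: nq.
  have := edge_behind (esym wE') vr vl lr' nvl' nvr' sI' D0 empty'.
  rewrite !det_lin vrv lvv vra lva !mulr0 !add0r => /(_ (mulr_gt0 tp avr) (mulr_gt0
    tp alv)).
  rewrite !(det_swap (val l) (val r)) => d.
  have [|d1 d2] := d; last by split; apply/eqP; rewrite -oppr_eq0; apply/eqP.
  rewrite !mulrN -opprD oppr_ge0 (ray_param_diff _ tE).
  by apply: mulr_le0_ge0; rewrite ?subr_le0 // subr_ge0; exact: ltW (lt_trans Yn X0).
have neg (k : R) : k != 0 -> ~~ (0 < - k) -> 0 < k.
  by move=> k0; rewrite oppr_gt0 -leNgt lt_def k0.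
have nzY : dt l r v != 0 by rewrite -oppr_eq0 -YE.
have nzY' : dt l' r' v != 0 by rewrite -oppr_eq0 -YE'.
have Yp : 0 < dt l r v by apply: neg => //; rewrite -YE.
have Yp' : 0 < dt l' r' v by apply: neg => //; rewrite -YE'.
have D0 : 0 < dt v l r by rewrite -detC.
have tn := ray_param_neg X0 tE Yp t1.
have tn' := ray_param_neg X0' tE' Yp' t1'.
have empty' q : ~ in_triangle v l r q by case: (empty q).
have := edge_behind (esym wE') vl vr lr' nvl' nvr' sI' D0 empty'.
rewrite !det_lin vlv rvv (det_swap (val l) (val v)) (det_swap (val v) (val r)) vra lva.
rewrite !mulr0 !add0r !mulrN !oppr_gt0 !nmulr_rlt0 // (ray_param_diff _ tE) => d.
apply: d => //; apply: mulr_ge0; first by rewrite subr_ge0.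
exact: ltW (ray_param_XY tE tn Yp).
Qed.

Lemma side_face_unique f f' v bt : side_face f v bt -> side_face f' v bt -> f = f'.
Proof.
move=> [l [r [-> E [lv vr] bE em]]] [l' [r' [-> E' [lv' vr'] bE' em']]].
have [s [t h]] := ray_hit lv vr; have [s' [t' h']] := ray_hit lv' vr'.
have [tt|tt] := boolP (if bt then t' <= t else t <= t').
  by have [-> ->] := side_face_le E lv vr bE em E' lv' vr' bE' h h' tt.
have tt' : if bt then t <= t' else t' <= t.
  by move: tt; case: bt {bE bE'}; rewrite -ltNge => /ltW.
by have [-> ->] := side_face_le E' lv' vr' bE' em' E lv vr bE h' h tt'.
Qed.

Lemma side_apex_disjoint f f' v : side_face f v true -> apex_face f' v -> False.
Proof.
move=> [l [r [_ [_ _ lr] [lv vr] bE _]]] [x [_ [_ _ av] _ _]].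
have [|||| t [s cr]] := @crossing_of_signs _ _ a v l r.
- by rewrite detS oppr_lt0.
- by [].
- by rewrite detC; exact: angle_trans lv vr.
- by rewrite detS oppr_lt0 -bE.
exact: (no_crossing pT av lr cr).
Qed.

Lemma apex_face_unique f f' v : apex_face f v -> apex_face f' v -> f = f'.
Proof.
move=> [x [-> [ax xv av] D em]] [x' [-> [ax' xv' _] D' em']].
(* If [y'] came after [y], it would be in the angle of the empty triangle [a y v], hence beyond
   [y v], and the edge [a y'] would cross [y v]. *)
have key y y' : adj T a y' -> adj T y v -> 0 < dt a y v -> 0 < dt a y' v ->
    (forall q, ~ in_triangle a y v q) -> ~ 0 < dt a y y'.
  move=> ay' yv d d' em0 yy'.
  have [_ nyy' _] := det_pos_neq yy'; have [_ nyv _] := det_pos_neq d.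
  have [_ ny'v _] := det_pos_neq d'.
  have n0 : dt y v y' < 0.
    have := @det_neq0 _ _ genP y v y';
      rewrite nyv nyy' eq_sym ny'v => /(_ erefl erefl erefl) nz.
    rewrite lt_neqAle nz leNgt; apply/negP => h; apply: (em0 y').
    by split; [exact: yy' | exact: h | rewrite -detC; exact: d'].
  have [|||| t [s cr]] := @crossing_of_signs _ _ a y' y v => //.
  - by rewrite detS oppr_lt0.
  - by rewrite detC.
  exact: (no_crossing pT ay' yv cr).
have n1 := key x x' ax' xv D D' em; have n2 := key x' x ax xv' D' D em'.
case: (eqVneq x x') => [-> //|xx'].
have nz := det_neq0 genP (adj_neq pT ax) xx' (adj_neq pT ax').
move/negP: n1; move/negP: n2; rewrite (detS (val a) (val x)) oppr_gt0 -!leNgt => n2 n1.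
by case/negP: nz; rewrite eq_le n1 leNgt; apply/negP => h; rewrite leNgt h in n2.
Qed.

Lemma has_slot_unique f f' (s : P * bool) : has_slot f s -> has_slot f' s -> f = f'.
Proof.
case: s => v bt; rewrite /has_slot /=.
move=> [h|[bT h]] [h'|[bT' h']].
- exact: side_face_unique h h'.
- by rewrite bT' in h; case: (side_apex_disjoint h h').
- by rewrite bT in h'; case: (side_apex_disjoint h' h).
- exact: apex_face_unique h h'.
Qed.

(** Without [a], the middle vertex of a face is neither [b], first in the angular order, nor [c],
    the last, so it is interior. With [a], the later vertex is not [b] but may be [c]; this is the
    single extra slot. *)
Lemma face_has_slot f : is_face T f -> exists s : P * bool, has_slot f s /\
  (interior a b c s.1 \/ s = (c, true)).
Proof.
have apex_case x y : adj T a x -> adj T x y -> adj T y a -> 0 < dt a x y ->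
    (forall q, ~ in_triangle a x y q) -> exists s : P * bool, has_slot [set a; x;
      y]%SET s /\
  (interior a b c s.1 \/ s = (c, true)).
  move=> ax xy ya d em; exists (y, true); split.
    by right; split=> //; exists x; split=> //; split=> //; rewrite adjC.
  case: (eqVneq y c) => [->|yc]; [by right | left => /=].
  rewrite /interior !inE !negb_or yc andbT (eq_sym y b) (angle_b d) andbT.
  exact: adj_neq pT ya.
have side_case l v r : adj T l v -> adj T v r -> adj T l r -> 0 < dt a l v -> 0 < dt
  a v r ->
    (forall q, ~ in_triangle l v r q /\ ~ in_triangle v l r q) ->
    exists s : P * bool, has_slot [set l; v;
      r]%SET s /\ (interior a b c s.1 \/ s = (c, true)).
  move=> lv vr lr alv avr em; exists (v, 0 < dt l v r); split.
    by left; exists l, r.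
  left => /=; rewrite /interior !inE !negb_or (angle_c avr) andbT (eq_sym v b)
    (angle_b alv) andbT.
  by rewrite eq_sym; have [] := det_pos_neq avr.
move=> [x [y [z [-> [xy yz zx] D em]]]].
have rot p q r : [set p; q; r]%SET = [set q; r; p]%SET :> {set P}.
  by rewrite -finset.setUA finset.setUC.
have em1 q : ~ in_triangle y z x q by move=> [? ? ?]; case: (em q).
have em2 q : ~ in_triangle z x y q by move=> [? ? ?]; case: (em q).
case: (eqVneq a x) => [ax|ax]; first by subst; apply: apex_case.
case: (eqVneq a y) => [ay|ay].
  by rewrite rot; subst; apply: apex_case => //; rewrite detC.
case: (eqVneq a z) => [az|az].
  by rewrite rot rot; subst; apply: apex_case => //; rewrite -detC.
have noem l v r : dt l v r <= 0 -> forall q, ~ in_triangle l v r q.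
  move=> d q [q1 q2 q3]; move: d; rewrite (det_sum _ _ _ (val q)) leNgt => /negP; apply.
  by rewrite !addr_gt0 // -detC.
have neg p q r : 0 < dt p q r -> dt q p r <= 0.
  by move=> d; rewrite det_swap oppr_le0 ltW.
have D1 : 0 < dt y z x by rewrite detC.
have D2 : 0 < dt z x y by rewrite -detC.
have sgn u v : a != u -> a != v -> u != v -> 0 < dt a u v \/ 0 < dt a v u.
  move=> au av uv; have := det_neq0 genP au uv av; case: (ltgtP 0 (dt a u v)) => // h _.
    by left.
  by right; rewrite detS oppr_gt0.
have nxy := adj_neq pT xy; have nyz := adj_neq pT yz; have nzx := adj_neq pT zx.
have xz : adj T x z by rewrite adjC.
have yx : adj T y x by rewrite adjC.
have zy : adj T z y by rewrite adjC.
have em3 q : ~ in_triangle y x z q by apply: noem; exact: neg.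
have em4 q : ~ in_triangle z y x q by apply: noem; exact: neg.
have em5 q : ~ in_triangle x z y q by apply: noem; exact: neg.
have flip p q r : [set p; q; r]%SET = [set r; q; p]%SET :> {set P}.
  by rewrite finset.setUC (finset.setUC [set p]%SET) finset.setUA.
(* Of the eight sign patterns, the two cyclic ones contradict transitivity; the other six are the
   possible orders of the three vertices. *)
have [h1|h1] := sgn x y ax ay nxy; have [h2|h2] := sgn y z ay az nyz;
  have [h3|h3] := sgn z x az ax nzx.
- by case: (det_pos_asym (angle_trans h1 h2) h3).
- exact: side_case.
- by rewrite (rot x) (rot y); apply: side_case.
- by rewrite (flip x) (rot z) (rot y); apply: side_case.
- by rewrite (rot x); apply: side_case.
- by rewrite (flip x) (rot z); apply: side_case.
- by rewrite (flip x); apply: side_case.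
- by case: (det_pos_asym (angle_trans h2 h1) h3).
Qed.
End FaceSlots.

(** * Counting faces against points of degree 3 and 4 *)

Lemma leq_card_rel (A B : finType) (X : {set A}) (Y : {set B}) (r : A -> B -> Prop) :
  (forall x, x \in X -> exists2 y, y \in Y & r x y) ->
  (forall x x' y, r x y -> r x' y -> x = x') -> (#|X| <= #|Y|)%N.
Proof.
move=> rX rinj; have SomeI : injective (@Some A) by move=> ? ? [].
rewrite -(card_imset X SomeI).
apply: leq_trans (leq_imset_card (fun y => [pick x | `[< r x y >]]) Y).
apply: subset_leq_card; apply/fintype.subsetP => _ /imsetP[x xX ->].
have [y yY rxy] := rX x xX; apply/imsetP; exists y => //.
case: pickP => [x' /asboolP rx'y|/(_ x)]; first by rewrite (rinj _ _ _ rxy rx'y).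
by move/asboolP.
Qed.

(** Both sides are compared with the number of related pairs. *)
Lemma double_count (A B : finType) (X : {set A}) (Y : {set B}) (r : A -> B -> bool)
  (k m : nat) :
  (forall x, x \in X -> (k <= #|[set y in Y | r x y]%SET|)%N) ->
  (forall y, y \in Y -> (#|[set x in X | r x y]%SET| <= m)%N) ->
  (k * #|X| <= m * #|Y|)%N.
Proof.
move=> hX hY; rewrite mulnC -sum_nat_const mulnC -sum_nat_const.
apply: (@leq_trans (\sum_(x in X) \sum_(y in Y | r x y) 1)).
  by apply: leq_sum => x /hX; rewrite -sum1_card; under eq_bigl do rewrite inE.
rewrite (exchange_big_dep (mem Y)) /=; last by move=> x y _ /andP[].
apply: leq_sum => y yY; apply: leq_trans (hY y yY); rewrite -sum1_card.
by rewrite leq_eqVlt; apply/orP; left; apply/eqP; apply: eq_bigl => x; rewrite inE yY.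
Qed.

Section Counting.
Variables (R : realType) (P : {fset 'rV[R]_2}).
Hypothesis genP : no_three_collinear P.
Implicit Types (p q r u v w x y z i : P).
Variables (T : {set {set P}}) (a b c : P).
Hypotheses (mT : maximal_plane T) (H : is_hull a b c).
Let pT := proj1 mT.

Definition faces : {set {set P}} := [set f : {set P} | `[< is_face T f >]]%SET.

Lemma card_hull : #|[set a; b; c]%SET| = 3%N.
Proof. by have [/det_pos_neq[ab bc ac] _] := H; exact: cards3. Qed.

Lemma card_interior : #|[set p | interior a b c p]%SET| = (#|{: P}| - 3)%N.
Proof.
rewrite -card_hull -(cardsC [set a; b; c]%SET) addKn.
by congr #|pred_of_set _|; apply/setP => p; rewrite !inE.
Qed.

Lemma card_faces : (#|faces| <= 2 * (#|{: P}| - 3) + 1)%N.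
Proof.
pose Y : {set P * bool} :=
  (finset.setX [set p | interior a b c p] [set: bool] :|: [set (c, true)])%SET.
apply: (@leq_trans #|Y|).
  apply: (@leq_card_rel _ _ _ _ (fun f (s : P * bool) => has_slot T a f s)); last first.
    by move=> f f' s; exact: (has_slot_unique genP pT H).
  move=> f; rewrite inE => /asboolP /(face_has_slot genP pT H)[[v bt] [h hI]].
  exists (v, bt) => //; rewrite !inE /=.
  case: hI => [/= vI|[-> ->]]; [by rewrite vI | by rewrite eqxx orbT].
rewrite cardsU cards1 cardsX card_interior cardsT card_bool mulnC.
exact: leq_subr.
Qed.

Lemma is_face_card f : is_face T f -> (#|f| <= 3)%N.
Proof.
move=> [x [y [z [-> _ _ _]]]]; rewrite -finset.setUA cardsU1 cards2.
by case: (_ \notin _); case: (_ != _).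
Qed.

Lemma is_face_adj f x y : is_face T f -> x \in f -> y \in f -> x != y -> adj T x y.
Proof.
move=> [u [v [w [-> [uv vw wu] _ _]]]]; rewrite !inE.
by move=> /orP[/orP[]|] /eqP -> /orP[/orP[]|] /eqP ->; rewrite ?eqxx // adjC.
Qed.

Definition succ p x := odflt x [pick y | `[< next_nbr T p x y >]].

Lemma succP p x : interior a b c p -> x \in nbrs T p -> next_nbr T p x (succ p x).
Proof.
move=> pI; rewrite in_nbrs /succ => px; case: pickP => [y /asboolP //|none].
by have [y /asboolP] := next_exists genP mT H pI px; rewrite none.
Qed.

(** Distinct corners at [p] give distinct faces: two different [x], [x'] with the same face would be
    successors of each other. *)
Lemma leq_card_corners p (S : {set P}) (Y : {set {set P}}) : interior a b c p ->
  S \subset nbrs T p ->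
  (forall x, x \in S -> [set p; x; succ p x]%SET \in Y) ->
  (#|S| <= #|[set f in Y | p \in f]%SET|)%N.
Proof.
move=> pI /fintype.subsetP Sn SY.
have inj : {in S &, injective (fun x => [set p; x; succ p x]%SET)}.
  move=> x x' xS xS' /setP e.
  have n1 := succP pI (Sn _ xS); have n2 := succP pI (Sn _ xS').
  have [px _ _ _] := n1; have [px' _ _ _] := n2.
  have npx := adj_neq pT px; have npx' := adj_neq pT px'.
  have : x \in [set p; x'; succ p x']%SET by rewrite -e !inE eqxx orbT.
  rewrite !inE eq_sym (negPf npx) /= => /orP[/eqP //|/eqP xE].
  have : x' \in [set p; x; succ p x]%SET by rewrite e !inE eqxx orbT.
  rewrite !inE eq_sym (negPf npx') /= => /orP[/eqP //|/eqP xE'].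
  by rewrite -xE xE' in n2; case: (next_asym n1 n2).
rewrite -(card_in_imset inj); apply: subset_leq_card; apply/fintype.subsetP => f.
by case/imsetP => x xS ->; rewrite !inE SY // eqxx.
Qed.

Definition deg_interior k : {set P} := [set p | interior a b c p & #|nbrs T p| == k]%SET.
Definition free_faces : {set {set P}} := [set f in faces
  | [disjoint f & deg_interior 3]]%SET.

Lemma corner_in_faces p x : interior a b c p -> x \in nbrs T p ->
  [set p; x; succ p x]%SET \in faces.
Proof.
move=> pI /(succP pI) n; rewrite inE; apply/asboolP.
by have [] := next_face genP mT n.
Qed.

Lemma card_deg3 : (3 * #|deg_interior 3| + #|free_faces| <= #|faces|)%N.
Proof.
rewrite -(cardsID free_faces faces) addnC leq_add //.
  by apply: subset_leq_card; apply/fintype.subsetP => f; rewrite !inE => /andP[-> ->].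
rewrite -[leqRHS]mul1n.
apply: (@double_count P {set P} _ _ (fun p f => p \in f)) => [p|f].
  rewrite inE => /andP[pI /eqP p3]; rewrite -p3.
  apply: leq_card_corners => // x xn; rewrite inE corner_in_faces // andbT inE.
  rewrite corner_in_faces //=; apply/negP => /disjoint_setI0/setP/(_ p).
  by rewrite !inE eqxx pI p3 eqxx.
rewrite inE => /andP[_ fF]; rewrite leqNgt; apply/negP => /card_gt1P[x [y []]].
rewrite !inE => /andP[/andP[xI /eqP x3] xf] /andP[/andP[yI /eqP y3] yf] xy.
have fF' : is_face T f by apply/asboolP; move: fF; rewrite inE.
exact: (interior_degree3_nonadj genP mT H xI yI x3 y3 (is_face_adj fF' xf yf xy)).
Qed.

Lemma card_deg4 : (2 * #|deg_interior 4| <= 3 * #|free_faces|)%N.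
Proof.
apply: (@double_count P {set P} _ _ (fun p f => p \in f)) => [q|f]; last first.
  rewrite !inE => /andP[/asboolP fF _]; apply: leq_trans (is_face_card fF).
  by apply: subset_leq_card; apply/fintype.subsetP => x; rewrite inE => /andP[].
rewrite inE => /andP[qI /eqP q4].
(* A corner of [q] is spoiled when its first vertex ([X]) or its second ([X']) has degree 3. Each
   happens at most once, so at least two of the four corners give free faces. *)
pose X := [set x in nbrs T q | x \in deg_interior 3]%SET.
pose X' := [set x in nbrs T q | succ q x \in deg_interior 3]%SET.
have uniq3 x x' : x \in nbrs T q -> x' \in nbrs T q -> x \in deg_interior 3 ->
    x' \in deg_interior 3 -> x = x'.
  rewrite !in_nbrs !inE => qx qx' /andP[xI /eqP x3] /andP[xI' /eqP x3'].
  exact: (interior_degree4 genP mT H qI xI xI' q4 x3 x3' qx qx').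
have cX : (#|X| <= 1)%N.
  rewrite leqNgt; apply/negP => /card_gt1P[x [y []]]; rewrite !(inE, in_nbrs).
  move=> /andP[qx x3] /andP[qy y3] xy.
  by rewrite (uniq3 x y) ?inE ?eqxx in xy.
have cX' : (#|X'| <= 1)%N.
  rewrite leqNgt; apply/negP => /card_gt1P[x [y []]].
  rewrite inE => /andP[qx x3]; rewrite inE => /andP[qy y3] xy.
  have n1 := succP qI qx; have n2 := succP qI qy.
  have [_ s1 _ _] := n1; have [_ s2 _ _] := n2.
  rewrite -in_nbrs in s1; rewrite -in_nbrs in s2.
  rewrite (uniq3 _ _ s1 s2 x3 y3) in n1.
  by rewrite (next_inj genP mT n1 n2) eqxx in xy.
pose S := (nbrs T q :\: (X :|: X'))%SET.
have cS : (2 <= #|S|)%N.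
  have := cardsID (X :|: X')%SET (nbrs T q); rewrite q4 -/S.
  have : (#|nbrs T q :&: (X :|: X')| <= 2)%N.
    apply: leq_trans (subset_leq_card (finset.subsetIr _ _)) _.
    by rewrite cardsU (leq_trans (leq_subr _ _)) // (leq_add cX cX').
  by move: #|_ :&: _| #|S| => m [|[|k]] //; case: m => [|[|[|]]].
apply: leq_trans cS _; apply: leq_card_corners => // [|x].
  exact: subsetDl.
rewrite !(inE, in_nbrs) => /andP[nX qx]; move: nX; rewrite qx /= negb_or => /andP[nx ns].
have xn : x \in nbrs T q by rewrite in_nbrs.
have := corner_in_faces qI xn; rewrite inE => ->.
rewrite andTb finset.disjoints_subset; apply/fintype.subsetP => w; rewrite !inE.
by move=> /orP[/orP[]|] /eqP ->; rewrite ?nx ?ns // qI q4.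
Qed.
End Counting.

(** * The weight of a maximal plane graph *)

Section WeightBound.
Variables (R : realType) (P : {fset 'rV[R]_2}).
Hypothesis genP : no_three_collinear P.
Implicit Types (a b c p q r x y z i : P).
Variables (T : {set {set P}}).
Hypotheses (mT : maximal_plane T) (P5 : (5 <= #|{: P}|)%N).
Local Notation deg p := #|nbrs T p|.

Lemma pow_half_le k m : (m <= k)%N -> (2^-1 : R) ^+ k <= 2^-1 ^+ m.
Proof. by move=> mk; apply: ler_wiXn2l => //; lra. Qed.

(** Degree at least 5 contributes at most 1/32; degree 4 adds 1/32 to this base and degree 3 adds
    3/32. *)
Lemma interior_weight a b c : is_hull a b c ->
  \sum_(p | interior a b c p) (2^-1 : R) ^+ deg p
    <= (#|{: P}| - 3)%N%:R / 32 + 3 / 32 * #|deg_interior T a b c 3|%:R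
       + #|deg_interior T a b c 4|%:R / 32.
Proof.
move=> H; pose ind k p : R := ((p \in deg_interior T a b c k) : nat)%:R.
have indE k : \sum_(p | interior a b c p) ind k p = #|deg_interior T a b c k|%:R.
  rewrite -sum1_card natr_sum big_mkcond [RHS]big_mkcond /=; apply: eq_bigr => p _.
  by rewrite /ind inE; case: (interior a b c p); case: (_ == _).
have -> : (#|{: P}| - 3)%N%:R / 32 = \sum_(p | interior a b c p) (1 / 32 : R).
  by rewrite sumr_const -(card_interior H) cardsE -[RHS]mulr_natl mul1r.
rewrite -!indE mulr_sumr mulr_suml -!big_split /=.
apply: ler_sum => p pI; rewrite /ind !inE pI /=.
have d3 := interior_degree genP mT H pI.
case: (ltngtP (deg p) 4) => [d4|d4|->] /=.
- have -> : deg p = 3%N by apply/eqP; rewrite eqn_leq d3 -ltnS d4.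
  by rewrite !exprS expr0 /=; lra.
- rewrite (gtn_eqF (ltnW d4)); apply: le_trans (pow_half_le d4) _.
  by rewrite !exprS expr0 /=; lra.
- by rewrite !exprS expr0 /=; lra.
Qed.

(** At most one hull vertex has degree 3, which gives 1/8 + 1/16 + 1/16. Five points are what
    provides two interior ones. *)
Lemma hull_weight a b c : is_hull a b c ->
  \sum_(p in [set a; b; c]%SET) (2^-1 : R) ^+ deg p <= 1 / 4.
Proof.
move=> H; have H1 := is_hull_rot H; have H2 := is_hull_rot H1.
have [D _] := H; have [ab bc ac] := det_pos_neq D.
have rot x y z i : interior x y z i -> interior y z x i.
  by rewrite /interior -finset.setUA finset.setUC.
have [i [z [iI zI iz]]] : exists i z, [/\ interior a b c i, interior a b c z & i != z].
  have : (1 < #|[set p | interior a b c p]%SET|)%N by rewrite (card_interior H);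
    case: #|_| P5 => [|[|[|[|[|]]]]].
  by case/card_gt1P => i [z []]; rewrite !inE => iI zI iz; exists i, z.
have [iI1 zI1] := (rot _ _ _ _ iI, rot _ _ _ _ zI).
have [iI2 zI2] := (rot _ _ _ _ iI1, rot _ _ _ _ zI1).
have da := hull_degree genP mT H iI; have db := hull_degree genP mT H1 iI1.
have dc := hull_degree genP mT H2 iI2.
have nab := hull_degree3_unique genP mT H iI zI iz.
have nbc := hull_degree3_unique genP mT H1 iI1 zI1 iz.
have nca := hull_degree3_unique genP mT H2 iI2 zI2 iz.
have -> : \sum_(p in [set a; b; c]%SET) (2^-1 : R) ^+ deg p =
    2^-1 ^+ deg a + 2^-1 ^+ deg b + 2^-1 ^+ deg c.
  rewrite -finset.setUA big_setU1 ?inE ?negb_or ?ab ?ac //= big_setU1 ?inE //= big_set1.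
  by rewrite addrA.
have w3 p : (3 <= deg p)%N -> (2^-1 : R) ^+ deg p <= 1 / 8.
  by move=> h; apply: le_trans (pow_half_le h) _; rewrite !exprS expr0; lra.
have w4 p : (3 <= deg p)%N -> deg p <> 3%N -> (2^-1 : R) ^+ deg p <= 1 / 16.
  move=> h /eqP h'; have h4 : (4 <= deg p)%N by rewrite ltn_neqAle eq_sym h'.
  by apply: le_trans (pow_half_le h4) _; rewrite !exprS expr0; lra.
case: (eqVneq (deg a) 3%N) => [a3|/eqP a3].
  have nc : deg c <> 3%N by move=> c3; exact: nca.
  have := w3 _ da; have := w4 _ db (nab a3); have := w4 _ dc nc.
  by move: (_ ^+ deg a) (_ ^+ deg b) (_ ^+ deg c) => u v w; lra.
case: (eqVneq (deg b) 3%N) => [b3|/eqP b3].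
  have := w4 _ da a3; have := w3 _ db; have := w4 _ dc (nbc b3).
  by move: (_ ^+ deg a) (_ ^+ deg b) (_ ^+ deg c) => u v w; lra.
have := w4 _ da a3; have := w4 _ db b3; have := w3 _ dc.
by move: (_ ^+ deg a) (_ ^+ deg b) (_ ^+ deg c) => u v w; lra.
Qed.

Lemma maximal_weight a b c : is_hull a b c ->
  \sum_(p : P) (2^-1 : R) ^+ deg p < 11 * #|{: P}|%:R / 112.
Proof.
move=> H; rewrite (bigID (mem [set a; b; c]%SET)) /=.
have hI := interior_weight H; have hH := hull_weight H.
have h34 := card_deg3 genP mT H; have h4 := card_deg4 genP mT H.
have hF := card_faces genP mT H.
have hN : (#|deg_interior T a b c 3| + #|deg_interior T a b c 4| <= #|{: P}| - 3)%N.
  rewrite -(card_interior H) -cardsUI.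
  rewrite (_ : _ :&: _ = finset.set0)%SET ?cards0 ?addn0.
    apply: subset_leq_card; apply/fintype.subsetP => p; rewrite !inE.
    by case/orP => /andP[].
  by apply/setP => p; rewrite !inE; case: eqP => [->|]; rewrite !andbF ?andbF.
move: hI hH h34 h4 hF hN; rewrite /interior.
set N := (#|{: P}| - 3)%N;
  have -> : #|{: P}| = (N + 3)%N by rewrite /N subnK // ltnW // ltnW.
move: (\sum_(i in _) _) (\sum_(i | _) _) => s1 s2.
move: #|deg_interior T a b c 3| #|deg_interior T a b c 4| #|free_faces T a b c|
  #|faces T| N => A3 A4 Fr F N hI hH h34 h4 hF hN.
(* The target multiplied by 224. The counts give 9 [A3] + 2 [A4] <= 6 [N] + 3; twice this plus three
   times [A3] + [A4] <= [N] yields 21 [A3] + 7 [A4] <= 15 [N] + 6, and 15 [N] + 10 is allowed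
   strictly. *)
have : (N * 7 + A3 * 21 + A4 * 7 + 56 < N * 22 + 66)%N by lia.
rewrite -(ltr_nat R) !natrD !natrM.
move: hI hH; move: (N%:R) (A3%:R) (A4%:R) => n a3 a4.
by lra.
Qed.
End WeightBound.

(** * Averaging over all plane graphs *)

Section IsolatedVertices.
Variables (R : realType) (P : {fset 'rV[R]_2}).
Hypothesis genP : no_three_collinear P.
Implicit Types (p q r x y z i : P) (G H T : {set {set P}}).

Definition strip p G : {set {set P}} := [set e in G | p \notin e]%SET.

Definition visible p H : {set P} :=
  [set y | (y != p) && `[< forall e, e \in H -> noncrossing [set p; y]%SET e >]]%SET.

Definition star p (A : {set P}) : {set {set P}} := [set [set p; y]%SET | y in A]%SET.

Lemma strip_strip p G : strip p (strip p G) = strip p G.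
Proof. by apply/setP => e; rewrite !inE -andbA andbb. Qed.

Lemma strip_id p G : degree G p = 0%N -> strip p G = G.
Proof.
move=> /eqP; rewrite cards_eq0 => /eqP d0; apply/setP => e; rewrite inE.
have := congr1 (fun A : {set {set P}} => e \in A) d0; rewrite !inE.
by case: (e \in G) => //= ->.
Qed.

Lemma strip_star p H (A : {set P}) : strip p H = H -> strip p (H :|: star p A)%SET = H.
Proof.
move=> HE; apply/setP => e; rewrite -[in RHS]HE !inE.
have [eS|] := boolP (e \in star p A); last by rewrite orbF.
by case/imsetP: eS => y _ ->; rewrite !inE eqxx /= !andbF.
Qed.

Lemma noncrossing_star p y y' : y != p -> y' != p ->
  [set p; y]%SET != [set p; y']%SET -> noncrossing [set p; y]%SET [set p; y']%SET.
Proof.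
rewrite eq_sym => py; rewrite eq_sym => py' ne.
case: (noncrossing_or_crossing genP py py' ne) => // [[t [s [_ []]]]].
by rewrite eqxx.
Qed.

Lemma plane_graph_star p H (A : {set P}) : plane_graph H -> A \subset visible p H ->
  plane_graph (H :|: star p A)%SET.
Proof.
move=> [H2 Hnc] /fintype.subsetP Av.
have vis y : y \in A -> y != p /\ forall e, e \in H -> noncrossing [set p; y]%SET e.
  by move=> /Av; rewrite inE => /andP[yp /asboolP].
split=> [e|e f].
  rewrite !inE => /orP[/H2 //|/imsetP[y /vis[yp _] ->]].
  by rewrite cards2 eq_sym yp.
rewrite !inE => /orP[eH|/imsetP[y /vis[yp yv] ->]] /orP[fH|/imsetP[y' /vis[yp' yv'] ->]] ef.
- exact: Hnc.
- exact/noncrossing_sym/yv'.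
- exact: yv.
- exact: noncrossing_star.
Qed.

Lemma star_inj p H : {in powerset (visible p H) &,
  injective (fun A => strip p H :|: star p A)%SET}.
Proof.
move=> A B; rewrite !inE => /fintype.subsetP Av /fintype.subsetP Bv /setP E.
have key (C D : {set P}) : (forall y, y \in C -> y != p) ->
    (forall e, (e \in strip p H :|: star p C) = (e \in strip p H :|: star p D))%SET ->
    forall y, y \in C -> y \in D.
  move=> Cp CD y yC; have := CD [set p; y]%SET.
  rewrite !inE eqxx andbF /= (imset_f (fun y => [set p;
    y]%SET) yC) => /esym/imsetP[z zD yz].
  have : y \in [set p; z]%SET by rewrite -yz !inE eqxx orbT.
  by rewrite !inE (negPf (Cp _ yC)) => /eqP ->.
have Ap y : y \in A -> y != p by move=> /Av; rewrite inE => /andP[].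
have Bp y : y \in B -> y != p by move=> /Bv; rewrite inE => /andP[].
apply/setP => y; apply/idP/idP; first exact: (key A B).
by apply: (key B A) => // e; rewrite E.
Qed.

(** Each subset of the points visible from [p] yields a graph of the fibre, and the subset can be
    read off from the edges at [p]. *)
Lemma fiber_card p H : plane_graph H -> strip p H = H ->
  (2 ^ #|visible p H| <= #|[set G in plane_graphs P | strip p G == H]%SET|)%N.
Proof.
move=> pH HE; rewrite -card_powerset -(card_in_imset (@star_inj p H)).
apply: subset_leq_card; apply/fintype.subsetP => G /imsetP[A]; rewrite inE => Av ->.
rewrite !inE HE strip_star // eqxx andbT; apply/asboolP.
exact: plane_graph_star.
Qed.

(** Group the graphs by [strip p G = H]. In a fibre at most [H] itself has [p] isolated, while at
    least [2 ^ k] graphs carry weight [2 ^- k] on the right, where [k] points are visible. *)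
Lemma isolated_le_visible p :
  \sum_(G in plane_graphs P) ((degree G p == 0%N) : nat)%:R <=
  \sum_(G in plane_graphs P) (2^-1 : R) ^+ #|visible p (strip p G)|.
Proof.
rewrite (partition_big (strip p) predT) //= [leRHS](partition_big (strip p) predT) //=.
apply: ler_sum => H _.
have [pH|npH] := boolP ((H \in plane_graphs P) && (strip p H == H)); last first.
  rewrite big1; first by apply: sumr_ge0 => G _; apply: exprn_ge0; rewrite invr_ge0.
  move=> G /andP[GP /eqP sG]; case: eqP => // /strip_id GE.
  by case/negP: npH; rewrite -sG strip_strip eqxx andbT GE.
have [HP /eqP HE] := andP pH.
have pH' : plane_graph H by move: HP; rewrite inE => /asboolP.
apply: (@le_trans _ _ 1).
  apply: (@le_trans _ _ (\sum_(G in [set H]%SET) 1)); last by rewrite big_set1.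
  rewrite big_mkcond [leRHS]big_mkcond; apply: ler_sum => G _; rewrite inE.
  case: ifP => [/andP[_ /eqP sG]|_]; last by case: ifP.
  case: (eqVneq (degree G p) 0%N) => [/strip_id GE|_] /=; last by case: ifP.
  by rewrite -sG GE eqxx.
rewrite (eq_bigr (fun=> (2^-1 : R) ^+ #|visible p H|)) => [|G /andP[_ /eqP ->] //].
rewrite sumr_const -[_ *+ #|_|]mulr_natl.
have := fiber_card pH' HE; rewrite -(ler_nat R) natrX => h.
rewrite exprVn ler_pdivlMr ?exprn_gt0 // mul1r; apply: le_trans h _.
by rewrite cardsE.
Qed.

Lemma visible_nbrs p G T : plane_graph T -> G \subset T ->
  nbrs T p \subset visible p (strip p G).
Proof.
move=> [T2 Tnc] /fintype.subsetP GT; apply/fintype.subsetP => y; rewrite !inE => py.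
have yp := adj_neq (conj T2 Tnc) py; rewrite eq_sym yp; apply/asboolP => e.
rewrite inE => /andP[/GT eT pe]; apply: Tnc => //.
by apply: contraNneq pe => <-; rewrite !inE eqxx.
Qed.

(** After exchanging the sums over points and graphs, each graph [G] is compared with a maximal
    plane graph containing it. Strictness survives summation because the empty graph is plane. *)
Lemma vhat0_lt (k : R) :
  (forall T, maximal_plane T -> \sum_(p : P) (2^-1 : R) ^+ #|nbrs T p| < k) ->
  vhat 0 P < k.
Proof.
move=> bound; rewrite /vhat.
have P0 : (finset.set0 : {set {set P}}) \in plane_graphs P.
  by rewrite inE; apply/asboolP; split=> [e|e f]; rewrite inE.
have N0 : (0 : R) < #|plane_graphs P|%:R by rewrite ltr0n card_gt0; apply/set0Pn;
  exists finset.set0.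
rewrite mulrC ltr_pdivrMr // mulr_natr -sumr_const.
apply: (@le_lt_trans _ _ (\sum_(G in plane_graphs P)
    \sum_(p : P) (2^-1 : R) ^+ #|visible p (strip p G)|)).
  rewrite [leRHS]exchange_big /=.
  rewrite (eq_bigr (fun G => \sum_(p : P) ((degree G p == 0%N) : nat)%:R)).
    by rewrite exchange_big /=; apply: ler_sum => p _; exact: isolated_le_visible.
  move=> G _; rewrite /v_ -sum1_card natr_sum big_mkcond /=.
  by apply: eq_bigr => p _; rewrite inE; case: (_ == _).
apply: ltr_sum; first by apply/hasP; exists finset.set0; rewrite ?mem_index_enum.
move=> G; rewrite inE => /asboolP /maximal_plane_exists[T mT GT].
apply: le_lt_trans (bound T mT); apply: ler_sum => p _.
apply: pow_half_le; apply: subset_leq_card.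
exact: visible_nbrs (proj1 mT) GT.
Qed.

End IsolatedVertices.

(** * From the convex hull to three hull vertices in [P] *)

Section TriangularHull.
Variable R : realType.
Implicit Types (a b c z : 'rV[R]_2) (P : {fset 'rV[R]_2}).

Lemma convex_setP (C : set 'rV[R]_2) :
  (forall x y t, 0 <= t <= 1 -> C x -> C y -> C (lin t x y)) ->
  convex_set C.
Proof.
move=> hC x y l; rewrite !inE => Cx Cy.
have -> : conv l x y = lin (1 - l%:num) x y by rewrite linC lin.unlock addrC.
apply: hC => //; apply/andP; split; [rewrite subr_ge0; exact: le1 | rewrite gerBl;
  exact: ge0].
Qed.

Definition hull_triangle a b c : set 'rV[R]_2 :=
  [set z | [/\ 0 <= det a b z, 0 <= det b c z & 0 <= det c a z]]%classic.

Lemma convex_comb_ge0 (t u v : R) : 0 <= t <= 1 -> 0 <= u -> 0 <= v -> 0 <= (1 - t) *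
  u + t * v.
Proof.
move=> /andP[t0 t1] u0 v0; apply: addr_ge0; apply: mulr_ge0 => //.
by rewrite subr_ge0.
Qed.

Lemma hull_sub_triangle (A : set 'rV[R]_2) a b c : 0 < det a b c ->
  convex_hull A = convex_hull [set a; b; c]%classic -> (A `<=` hull_triangle a b c)%classic.
Proof.
move=> D E; apply: (@subset_trans _ (convex_hull A)); first exact: sub_gen_smallest.
rewrite E; apply: smallest_sub.
  apply: convex_setP => x y t tI [? ? ?] [? ? ?].
  by split; rewrite det_lin; exact: convex_comb_ge0.
have e1 := det_xx a b; have e2 := det_xx b c; have e3 := det_xx c a.
have D1 : 0 < det b c a by rewrite detC.
have D2 : 0 < det c a b by rewrite -detC.
have [_ aba abb'] := e1; have [_ bcb bcc'] := e2; have [_ cac caa'] := e3.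
have [_ _ abb] := det_xx b a; have [_ _ bcc] := det_xx c b; have [_ _ caa] := det_xx a c.
move=> z [[->|->]|->]; split; rewrite ?aba ?abb ?bcb ?bcc ?cac ?caa //; exact: ltW.
Qed.

(* If the vertex [a] were missing from [A], then the triangle cut off strictly
   before [a] would be a convex set containing [A] but not [a]. *)
Lemma hull_vertex_mem (A : set 'rV[R]_2) a b c : 0 < det a b c ->
  convex_hull A = convex_hull [set a; b; c]%classic -> A a.
Proof.
move=> D E; apply: contrapT => nAa; have AT := hull_sub_triangle D E.
pose C : set 'rV[R]_2 := [set z | hull_triangle a b c z /\ det b c z < det a b c]%classic.
have : convex_hull A a by rewrite E; apply: sub_gen_smallest; left; left.
have hAC : (convex_hull A `<=` C)%classic.
  apply: smallest_sub.
    apply: convex_setP => x y t tI [[x1 x2 x3] xD] [[y1 y2 y3] yD]; split.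
      by split; rewrite det_lin; exact: convex_comb_ge0.
    rewrite det_lin -subr_gt0.
    rewrite (_ : _ - _ = (1 - t) * (det a b c - det b c x) + t * (det a b c - det b c
      y)); last by ring.
    move/andP: tI => [t0 t1]; move: xD yD; rewrite -!(subr_gt0 (det b c _)) => xD yD.
    case: (eqVneq t 0) => [->|tn0]; first by rewrite subr0 mul1r mul0r addr0.
    apply: ltr_wpDl; first by apply: mulr_ge0; [rewrite subr_ge0 | exact: ltW].
    by apply: mulr_gt0; rewrite // lt_def tn0.
  move=> z Az; have [z1 z2 z3] := AT z Az; split=> //.
  rewrite ltNge; apply/negP => zD; apply: nAa.
  (* The three nonnegative forms at [z] sum to [det a b c]. If one of them reaches this value, the
     other two vanish and [z] is [a]. *)
  have S := det_sum a b c z; rewrite -(detC z a b) -(detC z b c) -(detC z c a) in S.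
  have zab : det a b z = 0 by clear -z1 z3 zD S; dlra.
  have zca : det c a z = 0 by clear -z1 z3 zD S; dlra.
  suff -> : a = z by [].
  apply: (point_eq (lt0r_neq0 D)).
    by rewrite zab; have [] := det_xx a b.
  by rewrite (det_swap c a z) zca oppr0; have [_ ->] := det_xx a c.
by move=> /hAC[_]; rewrite detC ltxx.
Qed.

Lemma hull_vertices P a b c : 0 < det a b c ->
  convex_hull [set` P]%classic = convex_hull [set a; b; c]%classic ->
  exists a' b' c' : P, is_hull a' b' c'.
Proof.
move=> D E; have AT := hull_sub_triangle D E.
have rot (u v w : 'rV[R]_2) : [set u; v; w]%classic = [set v; w; u]%classic.
  by rewrite -classical_sets.setUA classical_sets.setUC.
have D1 : 0 < det b c a by rewrite detC.
have D2 : 0 < det c a b by rewrite -detC.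
have aP : a \in P := hull_vertex_mem D E.
have E1 : convex_hull [set` P]%classic = convex_hull [set b; c; a]%classic by rewrite -rot.
have E2 : convex_hull [set` P]%classic = convex_hull [set c; a; b]%classic by rewrite -rot.
have bP : b \in P := hull_vertex_mem D1 E1.
have cP : c \in P := hull_vertex_mem D2 E2.
exists [` aP]%fset, [` bP]%fset, [` cP]%fset; split=> // q.
by apply: AT; exact: fsvalP.
Qed.

Lemma triangular_hullP P : triangular_hull P -> exists a b c : P, is_hull a b c.
Proof.
move=> [a [b [c [ncol E]]]].
have D0 : det a b c != 0.
  apply/eqP => D0; apply: ncol; case: (eqVneq a b) => [ab|ab]; last exact: collinear_det0.
  rewrite -ab; exists a, (c - a) => z; rewrite !inE => /or3P[] /eqP ->.
  - by exists 0; rewrite scale0r addr0.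
  - by exists 0; rewrite scale0r addr0.
  - by exists 1; rewrite scale1r addrC subrK.
(* A clockwise triangle is made counterclockwise by exchanging [b] and [c]. *)
case: (ltgtP 0 (det a b c)) => D; last by rewrite -D eqxx in D0.
  exact: (hull_vertices D E).
apply: (@hull_vertices P a c b); first by rewrite detS oppr_gt0.
by rewrite E -!classical_sets.setUA (classical_sets.setUC [set b]%classic).
Qed.

End TriangularHull.

Theorem theorem1p2 (R : realType) (n : nat) (P : {fset 'rV[R]_2})
    (n_ge5 : (5 <= n)%N) (card_P : #|` P| = n)
    (genP : no_three_collinear P) (hullP : triangular_hull P) :
  vhat 0 P < 11 * n%:R / 112 :> R /\
  11 * n%:R / 112 < n%:R / (1018 / 100) :> R.
Proof.
have nE : #|{: P}| = n by rewrite -card_P cardfE.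
have n0 : (0 : R) < n%:R by rewrite ltr0n; exact: leq_trans n_ge5.
(* The second inequality amounts to 11 * 1018 = 11198 < 11200. *)
split; last by lra.
have [a [b [c H]]] := triangular_hullP hullP.
apply: vhat0_lt => // T mT; rewrite -nE.
by apply: (maximal_weight genP mT _ H); rewrite nE.
Qed.
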